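(* Let $(\mathscr P_0,\mathscr A)$ be a pair with property (P), and suppose that $$\partial_t\mu_t=L^*_{t,\mu_t}\mu_t,\qquad\partial_t\nu_t=\bar L^*_{t,\mu_t}\nu_t\qquad(\mathrm{FP})$$ is well-posed in $\big((\mathscr P_0,\mathscr A),(\mathscr P,C([0,\infty)\to\mathscr P))\big)$. For $0\le s\le t$ and $(x,\zeta)\in\mathbb R^d\times\mathscr P_0$ let $$\mathbf P_{s,t}(x,\zeta;dy\,d\mu):=(\nu_{s,t}^{\zeta,\delta_x}\times\delta_{\mu_{s,t}^\zeta})(dy\,d\mu).$$ Then the family $\mathbf P_{s,t}(x,\zeta;\cdot)$, $0\le s\le t$, $(x,\zeta)\in\mathbb R^d\times\mathscr P_0$, is a Markov transition kernel on $\mathbb R^d\times\mathscr P_0$, i.e.: $(C_1)$ $\mathbf P_{s,t}(\cdot;A)$ is Borel measurable in $(x,\zeta)$ for any $0\le s\le t$ and any Borel set $A\subset\mathbb R^d\times\mathscr P_0$, and $\mathbf P_{s,s}(x,\zeta;\cdot)=\delta_{(x,\zeta)}$ for any $s\ge0$ and $(x,\zeta)\in\mathbb R^d\times\mathscr P_0$. $(C_2)$ The Chapman-Kolmogorov equations hold: for all $0\le s<r<t$ and $(x,\zeta)\in\mathbb R^d\times\mathscr P_0$, $$\mathbf P_{s,t}(x,\zeta;\cdot)=\int_{\mathbb R^d\times\mathscr P_0}\mathbf P_{r,t}(y,\mu;\cdot)\,\mathbf P_{s,r}(x,\zeta;dy,d\mu).$$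
   Context: Let $d,m\in\mathbb N$. $\mathscr P$ is the set of Borel probability measures on $\mathbb R^d$ with the weak topology and Borel $\sigma$-algebra $\mathscr B(\mathscr P)$; $C([s,\infty)\to\mathscr P_0)$ denotes weakly continuous paths in $\mathscr P_0\subset\mathscr P$. $b,\bar b:[0,\infty)\times\mathbb R^d\times\mathscr P\to\mathbb R^d$ and $\sigma,\bar\sigma:[0,\infty)\times\mathbb R^d\times\mathscr P\to\mathbb R^d\otimes\mathbb R^m$ are Borel measurable, $L_{t,\mu}h(x)=\frac12\sum_{i,j}(\sigma\sigma^* )_{ij}(t,x,\mu)\partial_i\partial_jh(x)+\sum_ib_i(t,x,\mu)\partial_ih(x)$, and $\bar L_{t,\mu}$ the same with $\bar b,\bar\sigma$. Property (P) for $(\mathscr P_0,\mathscr A)$ with $\mathscr P_0\in\mathscr B(\mathscr P)$, $\mathscr A\subset C([0,\infty)\to\mathscr P_0)$: if $\tilde\mu\in\mathscr P$ with $\tilde\mu\le C\mu$ for some $\mu\in\mathscr P_0$, $C\in(0,\infty)$, then $\tilde\mu\in\mathscr P_0$; if $(\lambda_t)_{t\ge0}\in\mathscr A$, then $(\lambda_{s+t})_{t\ge0}\in\mathscr A$ for all $s\ge0$, and $(\tilde\lambda_t)_{t\ge0}\in\mathscr A$ whenever $(\tilde\lambda_t)_{t\ge0}\in C([0,\infty)\to\mathscr P_0)$ and $\tilde\lambda_t\le C\lambda_t$ for all $t\ge0$ and some $C\in(0,\infty)$. Solutions (from time $s$): $(\mu_t)_{t\ge s}\in C([s,\infty)\to\mathscr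 P)$ solves the first equation if for all $t\ge s$, $\int_s^tdr\int(|b|+\|\sigma\|^2)(r,x,\mu_r)\mu_r(dx)<\infty$ and $\int h\,d\mu_t=\int h\,d\mu_s+\int_s^tdr\int L_{r,\mu_r}h\,d\mu_r$ for all $h\in C_0^\infty(\mathbb R^d)$. Given $(\mu_t)_{t\ge s}$, $(\nu_t)_{t\ge s}\in C([s,\infty)\to\mathscr P)$ solves the second equation if for all $t\ge s$, $\int_s^tdr\int(|\bar b|+\|\bar\sigma\|^2)(r,x,\mu_r)\nu_r(dx)<\infty$ and $\int h\,d\nu_t=\int h\,d\nu_s+\int_s^tdr\int\bar L_{r,\mu_r}h\,d\nu_r$ for all $h\in C_0^\infty(\mathbb R^d)$. (FP) is well-posed in $((\mathscr P_0,\mathscr A),(\mathscr P,C([0,\infty)\to\mathscr P)))$ if: (a) for every $(s,\zeta)\in[0,\infty)\times\mathscr P_0$ there is a unique solution $(\mu_{s,t}^\zeta)_{t\ge s}$ of the first equation from time $s$ with $\mu_{s,s}^\zeta=\zeta$ and $(\mu_{s,s+t}^\zeta)_{t\ge0}\in\mathscr A$, and $\zeta\mapsto\mu_{s,t}^\zeta$ is Borel measurable for all $t\ge s$; (b) for every $(s,\theta,\zeta)\in[0,\infty)\times\mathscr P\times\mathscr P_0$ there is a unique solution $(\nu_{s,t}^{\zeta,\theta})_{t\ge s}$ in $C([s,\infty)\to\mathscr P)$ from time $s$ of the second equation with $\mu_{s,r}^\zeta$ in place of $\mu_r$ and with $\nu_{s,s}^{\zeta,\theta}=\theta$, and $(\theta,\zeta)\mapsto\nu_{s,t}^{\zeta,\theta}$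 is Borel measurable for all $t\ge s$. *)

(* Defs.v *)
From HB Require Import structures.
From mathcomp Require Import all_boot all_order all_algebra.
From mathcomp Require Import all_classical all_reals all_analysis.
From mathcomp Require Import measurable_realfun.

Set Implicit Arguments.
Unset Strict Implicit.
Unset Printing Implicit Defensive.

Import Order.TTheory GRing.Theory Num.Theory.
Import numFieldNormedType.Exports.

Local Open Scope classical_set_scope.
Local Open Scope ring_scope.

Notation borel T := (@g_sigma_algebraType T open).

Section WeakTopology.
Context (R : realType) (d : nat).

Definition Cb :=
  {f : 'rV[R]_d -> R | continuous f /\ exists M : R, forall x, `|f x| <= M}.

(* A library measure is a function on all subsets, unconstrained outside of
   the sigma-algebra. Two elements of [Prob] therefore represent the same
   Borel probability measure when they agree on Borel sets ([meq] below); they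
   are then topologically indistinguishable in the weak topology. *)
Definition Prob := probability (borel 'rV[R]_d) R.

HB.instance Definition _ := Pointed.on Prob.

Definition meq (mu nu : Prob) :=
  forall B : set (borel 'rV[R]_d), measurable B -> mu B = nu B.

(* The coarsest topology making mu |-> \int f dmu continuous for all f in Cb. *)
HB.instance Definition _ := Topological.copy Prob
  (sup_topology (fun f : Cb => Topological.on
     (initial_topology (fun mu : Prob => (\int[mu]_x sval f x)%R)))).

Definition dirac_prob (x : 'rV[R]_d) : Prob :=
  [the probability (borel 'rV[R]_d) R of \d_(x : borel 'rV[R]_d)].

Definition dominated (C : R) (mu nu : Prob) :=
  forall B : set (borel 'rV[R]_d), measurable B -> (mu B <= C%:E * nu B)%E.

End WeakTopology.

Section TestFunctions.
Context (R : realType) (d : nat).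

Definition partial (i : 'I_d) (h : 'rV[R]_d -> R) : 'rV[R]_d -> R :=
  fun x => 'D_(delta_mx 0 i) h x.

Definition iter_partial (l : seq 'I_d) (h : 'rV[R]_d -> R) :=
  foldr partial h l.

Definition smooth (h : 'rV[R]_d -> R) :=
  forall l : seq 'I_d, continuous (iter_partial l h) /\
    forall (i : 'I_d) x, derivable (iter_partial l h) x (delta_mx 0 i).

Definition test_function (h : 'rV[R]_d -> R) :=
  smooth h /\ compact (closure [set x | h x != 0]).

End TestFunctions.

Section FokkerPlanck.
Context (R : realType) (d m : nat).
Local Notation Rd := 'rV[R]_d.
Local Notation P := (Prob R d).

(* Hilbert-Schmidt norm; on row vectors it is the Euclidean norm. *)
Definition hsnorm p q (M : 'M[R]_(p, q)) : R :=
  Num.sqrt (\sum_i \sum_j M i j ^+ 2).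

Definition borel_coef p q (f : R -> Rd -> P -> 'M[R]_(p, q)) :=
  measurable_fun
    ([set z | 0 <= z.1.1] : set (borel (R * Rd * P)%type))
    (fun z : borel (R * Rd * P)%type => f z.1.1 z.1.2 z.2 : borel 'M[R]_(p, q)).

Implicit Types (b bb : R -> Rd -> P -> Rd)
  (sigma bsigma : R -> Rd -> P -> 'M[R]_(d, m)).

Definition generator b sigma (t : R) (mu : P) (h : Rd -> R) (x : Rd) : R :=
  2^-1 * (\sum_i \sum_j
     (sigma t x mu *m (sigma t x mu)^T) i j * partial i (partial j h) x)
  + \sum_i b t x mu 0 i * partial i h x.

(* [FP_solution b sigma s mu nu]: from time [s], [nu] solves
     d/dt nu_t = L_{t, mu_t}^* nu_t.
   Taking [nu := mu] gives the nonlinear equation. Paths are functions on [R]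
   of which only the values on [s, oo) matter. *)
Definition FP_solution b sigma (s : R) (mu nu : R -> P) :=
  [/\ {within `[s, +oo[%classic, continuous nu},
      forall t, s <= t ->
        (\int[lebesgue_measure]_(r in `[s, t]) \int[nu r]_x
           (hsnorm (b r x (mu r)) + hsnorm (sigma r x (mu r)) ^+ 2)%:E < +oo)%E &
      forall t h, s <= t -> test_function h ->
        (\int[nu t]_x (h x)%:E = \int[nu s]_x (h x)%:E +
         \int[lebesgue_measure]_(r in `[s, t])
           \int[nu r]_x (generator b sigma r (mu r) h x)%:E)%E].

Definition paths_in (P0 : set P) (lam : R -> P) :=
  {within `[0, +oo[%classic, continuous lam} /\ forall t, 0 <= t -> P0 (lam t).

Definition property_P (P0 : set P) (A : set (R -> P)) :=
  [/\ measurable (P0 : set (borel P)),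
      A `<=` paths_in P0,
      forall (mu' mu : P) (C : R), P0 mu -> 0 < C -> dominated C mu' mu ->
        P0 mu',
      forall lam, A lam -> forall s, 0 <= s -> A (fun t => lam (s + t)) &
      forall lam' lam (C : R), A lam -> paths_in P0 lam' -> 0 < C ->
        (forall t, 0 <= t -> dominated C (lam' t) (lam t)) -> A lam'].

(* [well_posed b sigma bb bsigma P0 A mu nu]: (FP) is well-posed in
   ((P0, A), (P, C([0,oo) -> P))), [mu s t zeta] and [nu s t zeta theta] being
   the unique solutions (unique on [s, oo), as Borel measures). *)
Definition well_posed b sigma bb bsigma (P0 : set P) (A : set (R -> P))
    (mu : R -> R -> P -> P) (nu : R -> R -> P -> P -> P) :=
  [/\ forall (s : R) zeta, 0 <= s -> P0 zeta ->
        let is_solution mu' :=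
          [/\ FP_solution b sigma s mu' mu', meq (mu' s) zeta &
              A (fun t => mu' (s + t))] in
        is_solution (fun t => mu s t zeta) /\
        forall mu', is_solution mu' ->
          forall t, s <= t -> meq (mu' t) (mu s t zeta),
      forall s t : R, 0 <= s -> s <= t ->
        measurable_fun (P0 : set (borel P)) (mu s t : borel P -> borel P),
      forall (s : R) theta zeta, 0 <= s -> P0 zeta ->
        let is_solution nu' :=
          FP_solution bb bsigma s (fun r => mu s r zeta) nu' /\
          meq (nu' s) theta in
        is_solution (fun t => nu s t zeta theta) /\
        forall nu', is_solution nu' ->
          forall t, s <= t -> meq (nu' t) (nu s t zeta theta) &
      forall s t : R, 0 <= s -> s <= t ->
        measurable_fun
          ([set z | P0 z.2] : set (borel (P * P)%type))
          (fun z : borel (P * P)%type => nu s t z.2 z.1 : borel P)].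

(* The library's product measure lives on the product of the Borel
   sigma-algebras, which is the Borel sigma-algebra of the product topology
   because R^d is second countable. *)
Definition joint_kernel (mu : R -> R -> P -> P) (nu : R -> R -> P -> P -> P)
    (s t : R) (z : Rd * P) :
    {measure set (borel Rd * borel P)%type -> \bar R} :=
  [the {measure set _ -> \bar R} of
     (nu s t z.2 (dirac_prob z.1) \x \d_(mu s t z.2 : borel P))%E].

(* Markov transition kernel on E = R^d x P0, a Borel subset of R^d x P *)
Definition markov_kernel (P0 : set P)
    (K : R -> R -> Rd * P -> {measure set (borel Rd * borel P)%type -> \bar R}) :=
  let E : set (Rd * P) := setT `*` P0 in
  let borel_in_E (B : set (Rd * P)) :=
    measurable (B : set (borel (Rd * P)%type)) /\ B `<=` E in
  [/\ forall (s t : R) z, 0 <= s -> s <= t -> E z -> K s t z E = 1%E,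
      forall (s t : R) B, 0 <= s -> s <= t -> borel_in_E B ->
        measurable_fun (E : set (borel (Rd * P)%type))
          (fun z => K s t z B),
      forall (s : R) z B, 0 <= s -> E z -> borel_in_E B ->
        K s s z B = \d_(z : borel (Rd * P)%type) B &
      forall (s r t : R) z B, 0 <= s -> s < r -> r < t -> E z -> borel_in_E B ->
        K s t z B = (\int[K s r z]_(w in E) K r t w B)%E].

End FokkerPlanck.

(* Main.v *)
Require Import Defs.
From HB Require Import structures.
From mathcomp Require Import all_boot all_order all_algebra.
From mathcomp Require Import all_classical all_reals all_analysis.
From mathcomp Require Import measurable_realfun.
From mathcomp Require Import ring lra.
From mathcomp Require Import giry.

(** Only the Chapman-Kolmogorov equation is deep. Fix [s < r < t] and [(x, zeta)],
    and put [eta := mu s r zeta] and [theta := nu s r zeta (dirac_prob x)]. The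
    kernel from [s] to [r] is the product of [theta] and the Dirac measure at
    [eta], so the equation splits into a statement on [mu] and one on [nu].

    - A solution from time [s], looked at from time [r] on, solves the equation
      from time [r]. Uniqueness turns this into the flow properties
      [mu s t zeta = mu r t eta] and
      [nu s t zeta (dirac_prob x) = nu r t eta theta] ([mu_flow], [nu_flow]).

    - It remains to see that [nu r t eta theta] is the mixture under [theta] of
      the measures [nu r t eta (dirac_prob y)] ([solution_disintegration]). The
      second equation is linear in [nu], so the mixture should be a solution
      started at [theta], and uniqueness should conclude. But to be a solution
      includes the finiteness of the integrated cost [|bb| + |bsigma|^2]; this
      holds for each [y], while the total costs need not be integrable in [y]. So
      mixtures are only taken of families with integrable costs
      ([FP_superposition]). Given [e > 0], let [A] be a set with
      [theta (~` A) <= e] on which the costs up to every time are bounded. The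
      mixture of the solutions started at the Dirac measures in [A], and of the
      one solution started at [theta] conditioned on [~` A], has a finite cost
      and starts at [theta], so it is [nu r t eta theta]. Hence
      [nu r t eta theta] is within [e] of the mixture of all the
      [nu r t eta (dirac_prob y)], for every [e > 0].

    Measurability rests on two facts. As R^d is second countable, the Borel
    sigma-algebra of the product of R^d and the space of measures is the product
    of the Borel sigma-algebras ([borel_rV_prod]). And evaluation of measures at
    a Borel set is Borel for the weak topology ([measurable_Prob_eval]); together
    with the continuity of the solutions in time, this makes all the integrands
    of Fubini's theorem jointly measurable ([measurable_caratheodory]).

    Uniqueness identifies measures on Borel sets only ([meq]). Such measures have
    the same weak neighbourhoods, so Borel sets and Borel coefficients do not tell
    them apart ([borel_meq], [indistinguishable_coef]). *)

Import Order.TTheory GRing.Theory Num.Theory.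
Import numFieldNormedType.Exports.

Local Open Scope classical_set_scope.
Local Open Scope ring_scope.

Set Implicit Arguments.
Unset Strict Implicit.
Unset Printing Implicit Defensive.

(** * The weak topology on probability measures *)

Section WeakTopologyTheory.
Context (R : realType) (d : nat).
Local Notation Rd := 'rV[R]_d.
Local Notation P := (Prob R d).

Definition cb_int (f : Cb R d) (p : P) : R := (\int[p]_x sval f x)%R.

Lemma cvg_ProbP (F : set_system P) (p : P) : Filter F ->
  F --> p <-> forall f : Cb R d, cb_int f @ F --> cb_int f p.
Proof.
move=> FF; split=> [Fp f|Fp].
  have /cvg_sup/(_ f) Ff := Fp.
  exact: (continuous_cvg _ (@initial_continuous _ _ (cb_int f) p) Ff).
apply/cvg_sup => f A [B [[C oC <-] Cp] sBA].
by apply: filterS sBA _; apply: Fp; exact: open_nbhs_nbhs.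
Qed.

Lemma cb_int_continuous (f : Cb R d) : continuous (cb_int f).
Proof. by move=> p; have /cvg_ProbP := @cvg_id _ (nbhs p); apply. Qed.

Lemma continuous_ProbP (X : topologicalType) (g : X -> P) :
  continuous g <-> forall f : Cb R d, continuous (cb_int f \o g).
Proof.
split=> [cg f x|cg x].
  by apply: continuous_comp; [exact: cg|exact: cb_int_continuous].
by apply/cvg_ProbP => f; exact: cg.
Qed.

Lemma meq_cb_int (p q : P) (f : Cb R d) : meq p q -> cb_int f p = cb_int f q.
Proof.
move=> pq; rewrite /cb_int /Rintegral; congr fine.
by apply: eq_measure_integral => A mA _; exact: pq.
Qed.

(** Integrals of bounded continuous functions do not separate [p] from [q], so
    the two points have the same neighbourhoods. *)
Lemma meq_cvg (p q : P) : meq p q -> nbhs p --> q.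
Proof.
move=> pq; apply/cvg_ProbP => f; rewrite -(meq_cb_int f pq).
exact: cb_int_continuous.
Qed.

Lemma meq_sym (p q : P) : meq p q -> meq q p.
Proof. by move=> pq B mB; rewrite pq. Qed.

End WeakTopologyTheory.

(** * Borel sigma-algebras of topological spaces *)

Section BorelSets.

Lemma borel_open (T : ptopologicalType) (A : set T) :
  open A -> measurable (A : set (borel T)).
Proof. exact: sub_sigma_algebra. Qed.

Lemma borel_closed (T : ptopologicalType) (A : set T) :
  closed A -> measurable (A : set (borel T)).
Proof.
move=> cA; rewrite -(setCK A); apply: measurableC; apply: borel_open.
exact: closed_openC.
Qed.

Lemma measurable_fun_borel d (X : measurableType d) (T : ptopologicalType)
    (D : set X) (f : X -> borel T) : measurable D ->
  (forall A : set T, open A -> measurable (D `&` f @^-1` A)) ->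
  measurable_fun D f.
Proof.
move=> mD fo; apply: (@measurability _ _ X (borel T) D f open) => //.
by move=> _ [A oA <-]; exact: fo.
Qed.

Lemma continuous_borel (S T : ptopologicalType) (f : S -> T) :
  continuous f -> measurable_fun [set: borel S] (f : borel S -> borel T).
Proof.
move=> /continuousP cf; apply: measurable_fun_borel => // A oA.
by rewrite setTI; apply: borel_open; exact: cf.
Qed.

(** Open sets do not separate [x] from [y], and the sets that do not separate
    them form a sigma-algebra. This is what makes every Borel object on the
    space of probability measures insensitive to the values that a measure
    takes outside of the Borel sets. *)
Lemma borel_indistinguishable (T : ptopologicalType) (x y : T) (B : set T) :
  nbhs x --> y -> nbhs y --> x -> measurable (B : set (borel T)) -> B x <-> B y.
Proof.
move=> xy yx; move: B; apply: (@smallest_sub _ _ _ (fun B => B x <-> B y)).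
  split => /= [|A Axy|F Fxy].
  - by split.
  - by split=> -[_ nA]; split=> // /Axy.
  - by split => -[i _ /Fxy Fi]; exists i.
move=> A oA; split=> [Ax|Ay].
  by apply: nbhs_singleton; apply: yx; apply: open_nbhs_nbhs.
by apply: nbhs_singleton; apply: xy; apply: open_nbhs_nbhs.
Qed.

End BorelSets.

(* Lets the lemmas on [borel T] apply to a product [T]. *)
HB.instance Definition _ (X Y : ptopologicalType) := Pointed.on (X * Y)%type.

Section SecondCountability.
Context (R : realType).

Definition open_base_seq (T : topologicalType) (U : nat -> set T) :=
  (forall n, open (U n)) /\
  forall x A, nbhs x A -> exists n, U n x /\ U n `<=` A.

(** The base consists of the interiors of balls around the dense sequence, with
    radii tending to 0. *)
Lemma separable_open_base_seq (T : pseudoMetricType R) (I : countType)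
    (c : I -> T) : (forall x (e : R), 0 < e -> exists i, ball x e (c i)) ->
  exists U : nat -> set T, open_base_seq U.
Proof.
move=> cdense.
pose r (k : nat) : R := k.+1%:R^-1.
pose B (ik : I * nat) : set T := (ball (c ik.1) (r ik.2 + r ik.2))°.
exists (fun n => if unpickle n is Some ik then B ik else set0); split.
  by move=> n; case: unpickle => [ik|]; [exact: open_interior|exact: open0].
move=> x A /nbhs_ballP[e /= e0 eA].
have [k rk] : exists k, r k + (r k + r k) < e.
  have e3 : 0 < e / 3 by rewrite divr_gt0.
  have [k _ /(_ _ (leqnn k))] := near_infty_natSinv_lt (PosNum e3).
  move=> /= rk; exists k.
  have -> : e = e / 3 + (e / 3 + e / 3) by field.
  by rewrite !ltrD.
have r0 : 0 < r k by rewrite invr_gt0.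
have [i xi] := cdense x _ r0.
exists (pickle (i, k)); rewrite pickleK; split=> /=.
  apply/nbhs_ballP; exists (r k) => //= y xy.
  by apply: ball_triangle xy; exact: ball_sym.
move=> y /interior_subset cy; apply: eA; apply: (le_ball (ltW rk)).
exact: ball_triangle xi cy.
Qed.

Lemma rV_open_base_seq (d : nat) :
  exists U : nat -> set 'rV[R]_d, open_base_seq U.
Proof.
apply: (@separable_open_base_seq 'rV[R]_d 'rV[rat]_d (map_mx ratr)).
move=> x e e0.
have /choice[q qx] : forall j : 'I_d, exists q : rat,
    ratr q \in `](x 0 j - e), (x 0 j + e)[.
  by move=> j; apply: rat_in_itvoo; rewrite ltrBlDr -addrA ltrDl addr_gt0.
exists (\row_j q j); split => // i j; rewrite !mxE (ord1 i).
have := qx j; rewrite in_itv/= => /andP[q1 q2].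
by rewrite /ball/= ltr_distlC q1 q2.
Qed.

Lemma real_open_base_seq : exists U : nat -> set R, open_base_seq U.
Proof.
apply: (@separable_open_base_seq R rat ratr).
move=> x e e0; have [|q] := @rat_in_itvoo R (x - e) (x + e).
  by rewrite ltrBlDr -addrA ltrDl addr_gt0.
rewrite in_itv/= => /andP[q1 q2]; exists q.
by rewrite /ball/= ltr_distlC q1 q2.
Qed.

End SecondCountability.

(** One countable factor base is enough: [W] is the union over the base of [X]
    of [U n] times the largest open set whose product with [U n] lies in [W].
    This matters because the space of probability measures, used as [Y], comes
    without any countability. *)
Lemma open_prod_measurable (X Y : ptopologicalType) (U : nat -> set X)
    (W : set (X * Y)) : open_base_seq U -> open W ->
  measurable (W : set (borel X * borel Y)%type).
Proof.
move=> [oU bU] oW.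
pose V n := \bigcup_(V in [set V : set Y | open V /\ U n `*` V `<=` W]) V.
suff -> : W = \bigcup_n (U n `*` V n).
  apply: bigcupT_measurable => n; apply: measurableX.
    exact: borel_open.
  by apply: borel_open; apply: bigcup_open => ? [].
apply/seteqP; split => [[x y] Wxy|[x y] [n _ [/= Ux [A [_ AW] Ay]]]]; last first.
  exact: AW.
have : nbhs (x, y) W by apply: open_nbhs_nbhs.
move=> [[A B] [/= xA yB] ABW].
have [n [Unx UA]] := bU x A xA.
exists n => //; split => //=; exists B° => /=.
  split; first exact: open_interior.
  by move=> [x' y'] [/= /UA Ax' /interior_subset By']; exact: ABW.
exact: yB.
Qed.

Lemma borel_prod_measurable (X Y : ptopologicalType) (U : nat -> set X)
    (W : set (X * Y)) : open_base_seq U ->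
  measurable (W : set (borel (X * Y)%type)) ->
  measurable (W : set (borel X * borel Y)%type).
Proof.
move=> bU; apply: smallest_sub.
  exact: sigma_algebra_measurable.
by move=> A oA; exact: open_prod_measurable bU oA.
Qed.

Lemma prod_borel_measurable (X Y : ptopologicalType)
    (W : set (X * Y)) :
  measurable (W : set (borel X * borel Y)%type) ->
  measurable (W : set (borel (X * Y)%type)).
Proof.
have m1 : measurable_fun setT (fst : borel (X * Y)%type -> borel X).
  by apply: (@continuous_borel (X * Y)%type X) => -[x y]; exact: cvg_fst.
have m2 : measurable_fun setT (snd : borel (X * Y)%type -> borel Y).
  by apply: (@continuous_borel (X * Y)%type Y) => -[x y]; exact: cvg_snd.
have mid := measurable_fun_pair m1 m2.
move=> mW; have := mid measurableT W mW; rewrite setTI.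
by congr (measurable _); apply/seteqP; split=> -[].
Qed.

Lemma borel_realE (R : realType) (A : set R) :
  measurable (A : set (borel R)) <-> measurable (A : set R).
Proof.
split.
  apply: smallest_sub; first exact: sigma_algebra_measurable.
  by move=> B; exact: open_measurable.
move=> mA; have : (R.-ocitv.-measurable).-sigma.-measurable A by exact: mA.
rewrite RGenOpens.measurableE {mA}; move: A; apply: smallest_sub.
  exact: (sigma_algebra_measurable (borel R)).
by move=> A [x [y ->]]; apply: borel_open; exact: interval_open.
Qed.

(** * Evaluation of measures on Borel sets *)

Section Evaluation.
Context (R : realType) (d : nat).
Local Notation Rd := 'rV[R]_d.
Local Notation P := (Prob R d).

Lemma edist_inf_closed_gt0 (C : set Rd) x : closed C -> ~ C x ->
  (0 < edist_inf C x)%E.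
Proof.
move=> cC nCx; have : nbhs x (~` C).
  by apply: open_nbhs_nbhs; split; [exact: closed_openC|].
move=> /nbhs_ballP[e /= e0 xeC].
apply: (@lt_le_trans _ _ e%:E); first by rewrite lte_fin.
apply: le_ereal_inf_tmp => _ [a Ca <-]; rewrite leNgt; apply/negP => xa.
exact: (xeC a (edist_lt_ball xa)).
Qed.

Lemma edist_inf_fin_num (C : set Rd) x : C !=set0 ->
  edist_inf C x \is a fin_num.
Proof.
move=> [a Ca]; rewrite ge0_fin_numE ?edist_inf_ge0//.
apply: (@le_lt_trans _ _ (edist (x, a))).
  by apply: ereal_inf_lbound; exists a.
rewrite -ge0_fin_numE ?edist_ge0//; apply/edist_finP.
exists (`|x - a| + 1) => //=.
by rewrite -ball_normE /= ltrDl.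
Qed.

Definition mkCb (f : Rd -> R) (M : R) (cf : continuous f)
  (fM : forall x, `|f x| <= M) : Cb R d := exist _ f (conj cf (ex_intro _ M fM)).

(** The approximations are [min 1 (n * dist (x, ~` A))]. *)
Lemma open_indic_approx (A : set Rd) : open A ->
  exists phi : nat -> Cb R d, (forall n x, `|sval (phi n) x| <= 1) /\
    (forall x, sval (phi n) x @[n --> \oo] --> (\1_A x : R)).
Proof.
move=> oA.
(* The distance to the empty set is infinite. *)
have [A0|/set0P A0] := eqVneq (~` A) set0.
  have AT : A = setT by rewrite -(setCK A) A0 setC0.
  have c1 : continuous (fun _ : Rd => 1 : R) by exact: cst_continuous.
  have b1 (x : Rd) : `|1 : R| <= 1 by rewrite normr1.
  exists (fun _ => mkCb c1 b1); split=> [n x|x] /=; first by rewrite normr1.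
  by rewrite AT indicT; exact: cvg_cst.
pose D (x : Rd) := fine (edist_inf (~` A) x).
have D0 x : 0 <= D x by rewrite fine_ge0// edist_inf_ge0.
have cD : continuous D.
  move=> x; apply: fine_cvg; first exact: nbhs_filter.
  rewrite /D fineK ?edist_inf_fin_num//.
  exact: edist_inf_continuous.
pose phi n (x : Rd) : R := Num.min 1 (n%:R * D x).
have phi0 n x : 0 <= phi n x by rewrite le_min ler01 mulr_ge0.
have phi1 n x : `|phi n x| <= 1 by rewrite ger0_norm// ge_min lexx.
have phic n : continuous (phi n).
  move=> x; apply: (@continuous_min _ _ (cst 1) (fun x => n%:R * D x)).
    by apply: cvg_cst; exact: nbhs_filter.
  by apply: continuousM; [exact: cst_continuous|exact: cD].
exists (fun n => mkCb (phic n) (phi1 n)); split => //= x.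
have [Ax|nAx] := pselect (A x).
  have Dx : 0 < D x.
    rewrite /D -lte_fin fineK ?edist_inf_fin_num//.
    by apply: edist_inf_closed_gt0; [exact: open_closedC|exact].
  rewrite indicE mem_set//; apply: cvg_near_cst; near=> n.
  rewrite /phi min_l// -ler_pdivrMr// div1r.
  by near: n; exact: nbhs_infty_ger.
rewrite indicE memNset//; apply: cvg_near_cst; near=> n.
by rewrite /phi /D edist_inf0// fine0 mulr0 min_r.
Unshelve. all: by end_near. Qed.

Lemma continuous_measurable_rV (f : Rd -> R) : continuous f ->
  measurable_fun [set: borel Rd] (f : borel Rd -> R).
Proof.
move=> cf mT A mA; have /borel_realE mA' : measurable (A : set R) by [].
exact: (@continuous_borel Rd R f cf mT A mA').
Qed.

Lemma Cb_integrable (p : P) (f : Cb R d) :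
  p.-integrable [set: borel Rd] (EFin \o sval f).
Proof.
apply: measurable_bounded_integrable => //.
- by rewrite /= probability_setT ltry.
- by apply: continuous_measurable_rV; have [] := svalP f.
- have [_ [M fM]] := svalP f; exists M; split; first exact: num_real.
  by move=> x Mx y _; apply: le_trans (fM y) (ltW Mx).
Qed.

Lemma cb_intE (p : P) (f : Cb R d) :
  (cb_int f p)%:E = (\int[p]_x (sval f x)%:E)%E.
Proof.
rewrite /cb_int /Rintegral fineK//.
exact: (integrable_fin_num _ (Cb_integrable p f)).
Qed.

(** Sets [B] with this property form a Dynkin system; it contains the open sets,
    whose measure is a limit of integrals of bounded continuous functions, and
    these are stable under intersection. *)
Lemma measurable_eval d' (X : measurableType d') (D : set X) (k : X -> P) :
  measurable D ->
  (forall f : Cb R d, measurable_fun D (fun x => cb_int f (k x))) ->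
  forall B : set (borel Rd), measurable B -> measurable_fun D (fun x => k x B).
Proof.
move=> mD mk; apply: (@dynkin_induction _ (borel Rd) open
    (fun B => measurable_fun D (fun x => k x B))) => //.
- by move=> A B; exact: openI.
- rewrite (_ : (fun _ => _) = cst 1%E); first exact: measurable_cst.
  by apply/funext => x; exact: probability_setT.
- move=> A oA; have [phi [phi1 phiA]] := open_indic_approx oA.
  apply: (@emeasurable_fun_cvg _ _ _ _ (fun n x => (cb_int (phi n) (k x))%:E)).
    by move=> n; apply/measurable_EFinP; exact: mk.
  move=> x _; under eq_fun do rewrite cb_intE.
  have mA : measurable (A : set (borel Rd)) by exact: borel_open.
  have -> : k x A = (\int[k x]_(y in [set: borel Rd]) (\1_A y)%:E)%E.
    by rewrite integral_indic// setIT.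
  apply: (@dominated_cvg _ _ _ (k x) _ _ _ _ (cst 1%E)) => //.
  + move=> n; apply/measurable_EFinP.
    by apply: continuous_measurable_rV; have [] := svalP (phi n).
  + move=> y _; apply: cvg_EFin; first exact: nearW.
    exact: phiA.
  + exact: finite_measure_integrable_cst.
  + by move=> n y _; rewrite lee_fin.
- move=> S mS mkS; rewrite (_ : (fun _ => _) = (fun x => 1 - k x S)%E).
    by apply: emeasurable_funB => //; exact: measurable_cst.
  by apply/funext => x; rewrite probability_setC.
- move=> F mF tF mkF.
  rewrite (_ : (fun _ => _) = (fun x => \sum_(0 <= i <oo) k x (F i))%E).
    by apply: ge0_emeasurable_sum => // i _; exact: mkF.
  apply/funext => x; rewrite measure_bigcup//.
  by apply: eq_eseriesl => i; rewrite in_setT.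
Qed.

Lemma measurable_cb_int (f : Cb R d) :
  measurable_fun [set: borel P] (cb_int f : borel P -> R).
Proof.
move=> mT A mA; have /borel_realE mA' : measurable (A : set R) by [].
exact: (@continuous_borel P R _ (@cb_int_continuous R d f) mT A mA').
Qed.

Lemma measurable_Prob_eval (B : set (borel Rd)) : measurable B ->
  measurable_fun [set: borel P] (fun p : P => p B).
Proof. by apply: measurable_eval => // f; exact: measurable_cb_int. Qed.

End Evaluation.

(** * Probability kernels and their mixtures *)

Section Kernels.
Context (R : realType) (d : nat).
Local Notation Rd := 'rV[R]_d.
Local Notation P := (Prob R d).

(** The proof [mk] is an argument so that kernel structures can be attached to
    the family [k]. *)
Definition kernel_of d' (X : measurableType d') (k : X -> P)
    (mk : forall B : set (borel Rd), measurable B ->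
      measurable_fun [set: X] (fun x => k x B)) :
  X -> {measure set (borel Rd) -> \bar R} := k.

Section kernel_of_instances.
Context d' (X : measurableType d') (k : X -> P).
Variable mk : forall B : set (borel Rd), measurable B ->
  measurable_fun [set: X] (fun x => k x B).

HB.instance Definition _ := isKernel.Build _ _ X (borel Rd) R (kernel_of mk) mk.

Let kernel_ofT x : kernel_of mk x [set: borel Rd] = 1%E.
Proof. exact: probability_setT. Qed.

HB.instance Definition _ :=
  Kernel_isProbability.Build _ _ X (borel Rd) R (kernel_of mk) kernel_ofT.

End kernel_of_instances.

Lemma measurable_kernel_integral d' (X : measurableType d') (k : X -> P)
    (g : X * borel Rd -> \bar R) :
  (forall B : set (borel Rd), measurable B ->
    measurable_fun [set: X] (fun x => k x B)) ->
  (forall z, (0 <= g z)%E) -> measurable_fun [set: X * borel Rd] g ->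
  measurable_fun [set: X] (fun x => (\int[k x]_y g (x, y))%E).
Proof.
move=> mk g0 mg.
exact: (measurable_fun_integral_finite_kernel g (kernel_of mk) g0 mg).
Qed.

Section mixture_def.
Context d' (Y : measurableType d') (theta : probability Y R) (k : Y -> P).
Hypothesis mk : forall B : set (borel Rd), measurable B ->
  measurable_fun [set: Y] (fun y => k y B).

Let k' : Y -> giry (borel Rd) R := fun y => k y.

Let mk' : measurable_fun [set: Y] k'.
Proof. exact: measurable_giry_codensity. Qed.

Let mix : giry (borel Rd) R := giry_bind (theta : giry Y R) mk'.

Let ge0_integral_mix (f : borel Rd -> \bar R) :
  measurable_fun [set: borel Rd] f -> (forall x, (0 <= f x)%E) ->
  (\int[mix]_x f x = \int[theta]_y \int[k y]_x f x)%E.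
Proof. by move=> mf f0; exact: (giry_int_bind _ _ mf f0). Qed.

Let mixT : mix [set: borel Rd] = 1%E.
Proof.
rewrite -[LHS]mul1e -(integral_cst mix measurableT) ge0_integral_mix//.
rewrite (eq_integral (cst 1%E)); last first.
  by move=> y _; rewrite integral_cst// mul1e; exact: probability_setT.
by rewrite integral_cst// mul1e; exact: probability_setT.
Qed.

(** The mixture of the [k y] under [theta] is the bind of the Giry monad; it is
    characterized by its integrals of nonnegative functions. *)
Lemma mixture_exists : exists p : P, forall f : borel Rd -> \bar R,
  measurable_fun [set: borel Rd] f -> (forall x, (0 <= f x)%E) ->
  (\int[p]_x f x = \int[theta]_y \int[k y]_x f x)%E.
Proof.
pose m := HB.pack_for P (mix : set (borel Rd) -> \bar R)
  (Measure.on mix) (Measure_isProbability.Build _ _ _ mix mixT).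
by exists m.
Qed.

End mixture_def.
End Kernels.

(** * Functions continuous in time and measurable in a parameter *)

Section CaratheodoryFunction.
Context (R : realType) d' (Y : measurableType d').

(** [F] is the pointwise limit of the functions obtained by rounding time down
    to the multiples of [1 / n.+1], which depend on time through countably many
    values only. *)
Lemma measurable_caratheodory (F : R -> Y -> R) :
  (forall y, continuous (F ^~ y)) -> (forall u, measurable_fun [set: Y] (F u)) ->
  measurable_fun [set: (R * Y)%type] (fun z => F z.1 z.2).
Proof.
move=> cF mF.
pose s (n : nat) (u : R) : R := (Num.floor (u * n.+1%:R))%:~R / n.+1%:R.
apply: (@measurable_fun_cvg _ _ _ _ (fun n z => F (s n z.1) z.2)).
  move=> n _ A mA; rewrite setTI.
  pose E (k : int) := [set u : R | Num.floor (u * n.+1%:R) = k] `*`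
    (F (k%:~R / n.+1%:R) @^-1` A).
  rewrite [X in measurable X](_ : _ = \bigcup_k E k); last first.
    apply/seteqP; split => [[u y] /= Fuy|[u y] [k _ [/= <-]]//].
    by exists (Num.floor (u * n.+1%:R)).
  apply: countable_bigcupT_measurable; first exact: countableP.
  move=> k; apply: measurableX; last first.
    by rewrite -[X in measurable X]setTI; exact: mF.
  rewrite (_ : [set _ | _] =
    `[k%:~R / n.+1%:R, (k + 1)%:~R / n.+1%:R[%classic)//.
  apply/seteqP; split => u /=; rewrite in_itv/= ler_pdivrMr// ltr_pdivlMr//.
    by move=> <-; exact: floor_itv.
  by move=> ?; exact: floor_def.
move=> [u y] _ /=; apply: (continuous_cvg _ (cF y u)).
apply/cvgrPdist_lt => e e0; near=> n.
have n0 : 0 < n.+1%:R :> R by [].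
have /andP[s1 s2] := floor_itv (u * n.+1%:R).
have -> : u - s n u = (u * n.+1%:R - (Num.floor (u * n.+1%:R))%:~R) / n.+1%:R.
  by rewrite /s; field; rewrite lt0r_neq0// nat1r.
rewrite ger0_norm; last by rewrite divr_ge0// subr_ge0.
apply: (@le_lt_trans _ _ n.+1%:R^-1).
  rewrite ler_pdivrMr// mulVf ?gt_eqF// lerBlDl ltW//.
  by move: s2; rewrite intrD addrC.
by near: n; exact: (near_infty_natSinv_lt (PosNum e0)).
Unshelve. all: by end_near. Qed.

End CaratheodoryFunction.

(** * Paths and coefficients *)

Section ProductContinuity.
Context (X Y Z : topologicalType).

Lemma continuous_fst : continuous (@fst X Y).
Proof. by move=> [x y]; exact: cvg_fst. Qed.

Lemma continuous_snd : continuous (@snd X Y).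
Proof. by move=> [x y]; exact: cvg_snd. Qed.

Lemma continuous_pair (f : X -> Y) (g : X -> Z) : continuous f -> continuous g ->
  continuous (fun x => (f x, g x)).
Proof. by move=> cf cg x; exact: (cvg_pair (cf x) (cg x)). Qed.

Lemma continuous_comp2 (f : X -> Y) (g : Y -> Z) : continuous f -> continuous g ->
  continuous (fun x => g (f x)).
Proof. by move=> cf cg x; exact: (continuous_comp (cf x) (cg (f x))). Qed.

End ProductContinuity.

Section StoppedPaths.
Context (R : realType).

Lemma max_continuous (s : R) : continuous (fun u : R => Num.max u s).
Proof.
move=> u; apply: (@continuous_max R R (fun u => u) (cst s)); first exact: cvg_id.
exact: cst_continuous.
Qed.

(** A path that matters from time [s] on is turned into a path on the whole line
    by freezing it before [s]; continuity and measurability then need no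
    restriction to a half-line. *)
Lemma continuous_stopped (T : topologicalType) (f : R -> T) (s : R) :
  {within `[s, +oo[%classic, continuous f} ->
  continuous (fun u => f (Num.max u s)).
Proof.
move=> /subspace_continuousP cf u A fA.
have su v : `[s, +oo[%classic (Num.max v s).
  by rewrite /= in_itv/= andbT le_max lexx orbT.
have /(@max_continuous s u) := cf _ (su u) A fA; rewrite nbhs_simpl/=.
by apply: filterS => v /=; apply; exact: su.
Qed.

End StoppedPaths.

Section Coefficients.
Context (R : realType) (d m : nat).
Local Notation Rd := 'rV[R]_d.
Local Notation P := (Prob R d).
Implicit Types (b : R -> Rd -> P -> Rd) (sigma : R -> Rd -> P -> 'M[R]_(d, m)).

Lemma measurable_entry p q (i : 'I_p) (j : 'I_q) :
  measurable_fun [set: borel 'M[R]_(p, q)]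
    (fun A : borel 'M[R]_(p, q) => A i j : R).
Proof.
move=> mT A mA; have /borel_realE mA' : measurable (A : set R) by [].
exact: (@continuous_borel 'M[R]_(p, q) R _ (@coord_continuous R p q i j)
  mT A mA').
Qed.

Lemma measurable_ge0_time :
  measurable ([set z | 0 <= z.1.1] : set (borel (R * Rd * P)%type)).
Proof.
apply: borel_closed.
apply: (@closed_comp _ _ (fun z : R * Rd * P => z.1.1) [set x | 0 <= x]).
  move=> z _.
  exact: continuous_comp2 (@continuous_fst (R * Rd)%type P) (@continuous_fst R Rd) z.
exact: closed_ge.
Qed.

(** [f] is Borel on time, space and measures, and is composed with a continuous
    map from time and space; the product of the Borel sigma-algebras of time and
    space is the Borel one since time is second countable. *)
Lemma measurable_coef_path p q (f : R -> Rd -> P -> 'M[R]_(p, q)) (s : R)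
    (M : R -> P) (i : 'I_p) (j : 'I_q) :
  borel_coef f -> 0 <= s -> continuous M ->
  measurable_fun [set: (R * borel Rd)%type]
    (fun z : R * borel Rd => f (Num.max z.1 s) z.2 (M z.1) i j).
Proof.
move=> mf s0 cM _ A mA; rewrite setTI.
pose D := [set z : borel (R * Rd * P)%type | 0 <= z.1.1].
have mD : measurable D := measurable_ge0_time.
have mE : measurable (D `&` [set z | A (f z.1.1 z.1.2 z.2 i j)]).
  have := measurable_entry i j measurableT mA; rewrite setTI.
  exact: (mf mD).
pose Phi (z : R * Rd) : R * Rd * P := ((Num.max z.1 s, z.2), M z.1).
have cPhi : continuous Phi.
  apply: continuous_pair; first apply: continuous_pair.
  - exact: continuous_comp2 (@continuous_fst R Rd) (@max_continuous R s).
  - exact: continuous_snd.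
  - exact: continuous_comp2 (@continuous_fst R Rd) cM.
have := continuous_borel cPhi measurableT mE; rewrite setTI => mPhi.
have [U bU] := real_open_base_seq R.
have {}mPhi := borel_prod_measurable bU mPhi.
have mid : measurable_fun [set: (R * borel Rd)%type]
    (fun z : R * borel Rd => (z.1, z.2) : borel R * borel Rd).
  apply: measurable_fun_pair; last exact: measurable_snd.
  move=> mT B mB; have {}mB : measurable (B : set R) by exact/borel_realE.
  exact: (@measurable_fst _ _ R (borel Rd) mT _ mB).
have := mid measurableT _ mPhi; rewrite setTI.
congr (measurable _); apply/seteqP; split => -[u x] //=; first by case.
by move=> Af; split=> //; rewrite /D/= le_max s0 orbT.
Qed.

Lemma measurable_hsnorm d' (X : measurableType d') p q (f : X -> 'M[R]_(p, q)) :
  (forall i j, measurable_fun [set: X] (fun x => f x i j)) ->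
  measurable_fun [set: X] (fun x => hsnorm (f x)).
Proof.
move=> mf; have msqrt : measurable_fun [set: R] (Num.sqrt : R -> R).
  by apply: continuous_measurable_fun; exact: sqrt_continuous.
apply: (measurableT_comp msqrt).
by do 2 (apply: measurable_sum => ?); exact: measurable_funX.
Qed.

(** The integrand of the integrability condition in [FP_solution]. *)
Definition cost (b : R -> Rd -> P -> Rd) (sigma : R -> Rd -> P -> 'M[R]_(d, m))
  (r : R) (p : P) (x : Rd) : R := hsnorm (b r x p) + hsnorm (sigma r x p) ^+ 2.

Lemma cost_ge0 b sigma r p x : 0 <= cost b sigma r p x.
Proof. by rewrite addr_ge0 ?sqr_ge0 ?sqrtr_ge0. Qed.

Lemma measurable_cost b sigma (s : R) (M : R -> P) :
  borel_coef b -> borel_coef sigma -> 0 <= s -> continuous M ->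
  measurable_fun [set: (R * borel Rd)%type]
    (fun z : R * borel Rd => cost b sigma (Num.max z.1 s) (M z.1) z.2).
Proof.
move=> mb ms s0 cM; apply: measurable_funD.
  by apply: measurable_hsnorm => i j; exact: (measurable_coef_path i j mb s0 cM).
apply: measurable_funX; apply: measurable_hsnorm => i j.
exact: (measurable_coef_path i j ms s0 cM).
Qed.

Lemma partial_measurable (h : Rd -> R) (l : seq 'I_d) : test_function h ->
  measurable_fun [set: borel Rd] (iter_partial l h : borel Rd -> R).
Proof. by move=> [sh _]; apply: continuous_measurable_rV; have [] := sh l. Qed.

Lemma measurable_generator b sigma (s : R) (M : R -> P) h :
  borel_coef b -> borel_coef sigma -> 0 <= s -> continuous M ->
  test_function h ->
  measurable_fun [set: (R * borel Rd)%type]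
    (fun z : R * borel Rd => generator b sigma (Num.max z.1 s) (M z.1) h z.2).
Proof.
move=> mb ms s0 cM th; apply: measurable_funD.
  apply: measurable_funM; first exact: measurable_cst.
  apply: measurable_sum => i; apply: measurable_sum => j; apply: measurable_funM.
    under eq_fun do rewrite mxE.
    apply: measurable_sum => k; under eq_fun do rewrite mxE.
    by apply: measurable_funM; exact: (measurable_coef_path _ _ ms s0 cM).
  apply: (measurableT_comp (partial_measurable [:: i; j] th)).
  exact: measurable_snd.
apply: measurable_sum => i; apply: measurable_funM.
  exact: (measurable_coef_path _ _ mb s0 cM).
by apply: (measurableT_comp (partial_measurable [:: i] th)); exact: measurable_snd.
Qed.

Lemma iter_partial_out (h : Rd -> R) (l : seq 'I_d) x :
  ~ closure [set x | h x != 0] x -> iter_partial l h x = 0.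
Proof.
elim: l x => [|i l IH] x nx /=.
  apply/eqP; apply: contrapT => hx; apply: nx; apply: subset_closure.
  exact/negP.
rewrite /partial -(@derive_cst R _ R 0 x (delta_mx 0 i)); apply: near_eq_derive.
have : nbhs x (~` closure [set x | h x != 0]).
  by apply: open_nbhs_nbhs; split => //; apply: closed_openC; exact: closed_closure.
by apply: filterS => y; exact: IH.
Qed.

Lemma iter_partial_bounded (h : Rd -> R) (l : seq 'I_d) : test_function h ->
  exists2 C : R, 0 <= C & forall x, `|iter_partial l h x| <= C.
Proof.
move=> [sh ch]; have [cl _] := sh l.
have /compact_bounded[C [_ hC]] :=
  continuous_compact (continuous_subspaceT cl) ch.
exists (`|C| + 1); first by rewrite addr_ge0.
move=> x; have [xK|nxK] := pselect (closure [set x | h x != 0] x).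
  apply: hC; last by exists x.
  by rewrite (le_lt_trans (ler_norm C))// ltrDl.
by rewrite iter_partial_out// normr0 addr_ge0.
Qed.

Lemma entry_le_hsnorm p q (A : 'M[R]_(p, q)) i j : `|A i j| <= hsnorm A.
Proof.
rewrite /hsnorm -(sqrtr_sqr (A i j)) ler_sqrt; last first.
  by do 2 (apply: sumr_ge0 => ? _); exact: sqr_ge0.
rewrite (bigD1 i)//= (bigD1 j)//= -addrA lerDl addr_ge0//.
  by apply: sumr_ge0 => ? _; exact: sqr_ge0.
by do 2 (apply: sumr_ge0 => ? _); exact: sqr_ge0.
Qed.

(** The derivatives of a test function are bounded, being continuous with compact
    support, and an entry of [sigma *m sigma^T] is a sum of [m] products of two
    entries of [sigma]. So integrability of the cost makes [generator] absolutely
    integrable, which the equation itself does not say. *)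
Lemma generator_bounded b sigma h : test_function h ->
  exists2 C : R, 0 <= C &
    forall r p x, `|generator b sigma r p h x| <= C * cost b sigma r p x.
Proof.
move=> th.
have /choice[C1 C1P] : forall i, exists C, 0 <= C /\ forall x, `|partial i h x| <= C.
  by move=> i; have [C C0 hC] := iter_partial_bounded [:: i] th; exists C.
have /choice[C2 C2P] : forall ij : 'I_d * 'I_d, exists C, 0 <= C /\
    forall x, `|partial ij.1 (partial ij.2 h) x| <= C.
  by move=> [i j]; have [C C0 hC] := iter_partial_bounded [:: i; j] th; exists C.
pose K1 := \sum_i C1 i; pose K2 := \sum_i \sum_j m%:R * C2 (i, j).
have K10 : 0 <= K1 by apply: sumr_ge0 => i _; have [] := C1P i.
have K20 : 0 <= K2.
  apply: sumr_ge0 => i _; apply: sumr_ge0 => j _; rewrite mulr_ge0//.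
  by have [] := C2P (i, j).
exists (K2 + K1); first exact: addr_ge0.
move=> r p x; rewrite /generator /cost mulrDr.
set B := hsnorm (b r x p); set S := hsnorm (sigma r x p).
have B0 : 0 <= B by exact: sqrtr_ge0.
have S0 : 0 <= S by exact: sqrtr_ge0.
have h1 : `|\sum_i b r x p 0 i * partial i h x| <= K1 * B.
  apply: (le_trans (ler_norm_sum _ _ _)); rewrite /K1 mulr_suml.
  apply: ler_sum => i _; rewrite normrM mulrC; apply: ler_pM => //.
    by have [_] := C1P i.
  exact: entry_le_hsnorm.
have h2 : `|2^-1 * (\sum_i \sum_j (sigma r x p *m (sigma r x p)^T) i j *
    partial i (partial j h) x)| <= K2 * S ^+ 2.
  rewrite normrM ger0_norm ?invr_ge0//.
  apply: (@le_trans _ _ (1 * (K2 * S ^+ 2))); last by rewrite mul1r.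
  apply: ler_pM => //.
    by rewrite invf_le1// ler1n.
  apply: (le_trans (ler_norm_sum _ _ _)); rewrite /K2 mulr_suml.
  apply: ler_sum => i _; apply: (le_trans (ler_norm_sum _ _ _)); rewrite mulr_suml.
  apply: ler_sum => j _; rewrite normrM mulrAC; apply: ler_pM => //; last first.
    by have [_ /(_ x)] := C2P (i, j).
  rewrite mxE; apply: (le_trans (ler_norm_sum _ _ _)).
  rewrite -[m in m%:R]card_ord -sumr_const mulr_suml.
  apply: ler_sum => k _; rewrite mul1r expr2 normrM mxE.
  by apply: ler_pM => //; exact: entry_le_hsnorm.
apply: (le_trans (ler_normD _ _)); rewrite mulrDl.
have := mulr_ge0 K20 B0; have := mulr_ge0 K10 (sqr_ge0 S).
rewrite mulrDl; lra.
Qed.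

(** The fibre of [f] over its value at [(r, x, mu)] is a Borel set, and Borel sets
    do not separate [(r, x, mu)] from [(r, x, nu)]. *)
Lemma indistinguishable_coef p q (f : R -> Rd -> P -> 'M[R]_(p, q)) r x
    (mu nu : P) :
  borel_coef f -> 0 <= r -> meq mu nu -> f r x mu = f r x nu.
Proof.
move=> mf r0 mn.
pose D := [set z : borel (R * Rd * P)%type | 0 <= z.1.1].
have mD : measurable D := measurable_ge0_time.
have mE : measurable (D `&` [set z | f z.1.1 z.1.2 z.2 = f r x mu]).
  have mf1 : measurable ([set f r x mu] : set (borel 'M[R]_(p, q))).
    apply: borel_closed.
    by apply: accessible_closed_set1; exact: hausdorff_accessible (@norm_hausdorff _ _).
  exact: (mf mD _ mf1).
have cvgz (a c : P) : meq a c -> nbhs ((r, x), a) --> ((r, x), c).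
  move=> ac A [[U V] /= [xU cV] UVA]; exists (U, V) => //=; split => //.
  exact: (meq_cvg ac cV).
have [h _] :=
  borel_indistinguishable (cvgz _ _ mn) (cvgz _ _ (meq_sym mn)) mE.
by have [] := h (conj r0 erefl).
Qed.

End Coefficients.

(** * Integrals over time and space *)

Section TimeIntegrals.
Context (R : realType) (d : nat).
Local Notation Rd := 'rV[R]_d.
Local Notation P := (Prob R d).
Local Notation leb := (@lebesgue_measure R).

(** Along a continuous path, integrals of bounded continuous functions are
    continuous in time. *)
Lemma measurable_path_eval (N : R -> P) : continuous N ->
  forall B : set (borel Rd), measurable B ->
    measurable_fun [set: R] (fun u => N u B).
Proof.
move=> cN; apply: measurable_eval => // f; apply: continuous_measurable_fun.
by move/continuous_ProbP : cN; apply.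
Qed.

Section domination.
Variables (N : R -> P) (c g : R * borel Rd -> R) (C : R) (D : set R).
Hypotheses (mN : forall B : set (borel Rd), measurable B ->
              measurable_fun [set: R] (fun u => N u B))
  (mc : measurable_fun [set: R * borel Rd] c)
  (mg : measurable_fun [set: R * borel Rd] g)
  (c0 : forall z, 0 <= c z) (C0 : 0 <= C)
  (gc : forall z, `|g z| <= C * c z)
  (mD : measurable D)
  (cfin : (\int[leb]_(u in D) \int[N u]_x (c (u, x))%:E < +oo)%E).

Lemma measurable_pos_part : measurable_fun [set: R * borel Rd] ((EFin \o g)^\+)%E.
Proof. by apply: measurable_funepos; exact/measurable_EFinP. Qed.

Lemma measurable_neg_part : measurable_fun [set: R * borel Rd] ((EFin \o g)^\-)%E.
Proof. by apply: measurable_funeneg; exact/measurable_EFinP. Qed.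

Lemma dominated_time_integrable (f : R * borel Rd -> \bar R) :
  measurable_fun [set: R * borel Rd] f -> (forall z, (0 <= f z)%E) ->
  (forall z, (f z <= (C * c z)%:E)%E) ->
  leb.-integrable D (fun u => \int[N u]_x f (u, x))%E.
Proof.
move=> mf f0 fc; have mcE : measurable_fun [set: R * borel Rd] (EFin \o c).
  exact/measurable_EFinP.
have cE0 z : (0 <= (EFin \o c) z)%E by rewrite lee_fin.
have mcN := measurable_kernel_integral mN cE0 mcE.
have mcx u : measurable_fun [set: borel Rd] (fun x => (c (u, x))%:E).
  by apply: (measurableT_comp mcE); exact: pair1_measurable.
have ic0 u : (0 <= \int[N u]_x (c (u, x))%:E)%E.
  by apply: integral_ge0 => x _; exact: cE0.
have intc : leb.-integrable D (fun u => \int[N u]_x (c (u, x))%:E)%E.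
  apply/integrableP; split; first exact: measurable_funTS.
  by under eq_integral do rewrite (gee0_abs (ic0 _)).
apply: (@le_integrable _ _ _ leb D mD _
  (fun u => C%:E * \int[N u]_x (c (u, x))%:E)%E); last exact: integrableZl.
  by apply: measurable_funTS; exact: (measurable_kernel_integral mN f0 mf).
move=> u Du; rewrite !gee0_abs//; last 2 first.
- by rewrite mule_ge0// ?lee_fin.
- exact: integral_ge0.
rewrite -(ge0_integralZl (N u) measurableT (mcx u)) ?lee_fin//.
apply: ge0_le_integral => //.
- by apply: (measurableT_comp mf); exact: pair1_measurable.
- exact: (measurable_funeM _ (mcx u)).
- by move=> x _; exact: cE0.
Qed.

Lemma pos_part_le z : (((EFin \o g)^\+ z)%E <= (C * c z)%:E)%E.
Proof.
rewrite funeposE ge_max /= !lee_fin mulr_ge0// andbT.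
exact: le_trans (ler_norm _) (gc z).
Qed.

Lemma neg_part_le z : (((EFin \o g)^\- z)%E <= (C * c z)%:E)%E.
Proof.
rewrite funenegE ge_max /= !lee_fin mulr_ge0// andbT.
by apply: le_trans (gc z); rewrite -normrN ler_norm.
Qed.

Lemma time_integrable_pos :
  leb.-integrable D (fun u => \int[N u]_x ((EFin \o g)^\+ (u, x)))%E.
Proof. exact: dominated_time_integrable measurable_pos_part _ pos_part_le. Qed.

Lemma time_integrable_neg :
  leb.-integrable D (fun u => \int[N u]_x ((EFin \o g)^\- (u, x)))%E.
Proof. exact: dominated_time_integrable measurable_neg_part _ neg_part_le. Qed.

Lemma space_integralE u : (\int[N u]_x (g (u, x))%:E =
  \int[N u]_x ((EFin \o g)^\+ (u, x)) - \int[N u]_x ((EFin \o g)^\- (u, x)))%E.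
Proof.
have gE : (fun x => (g (u, x))%:E) = (EFin \o g) \o pair u by [].
by rewrite [LHS]integralE gE funepos_comp funeneg_comp.
Qed.

Lemma time_integrable : leb.-integrable D (fun u => \int[N u]_x (g (u, x))%:E)%E.
Proof.
under eq_fun do rewrite space_integralE.
by apply: integrableB => //; [exact: time_integrable_pos|exact: time_integrable_neg].
Qed.

(** Space integrals of [g] may be undefined at some times; the domination by [c]
    confines them to a null set and reduces signed integrals to Tonelli's theorem
    for the positive and negative parts. *)
Lemma time_integralE : (\int[leb]_(u in D) \int[N u]_x (g (u, x))%:E =
  \int[leb]_(u in D) \int[N u]_x ((EFin \o g)^\+ (u, x)) -
  \int[leb]_(u in D) \int[N u]_x ((EFin \o g)^\- (u, x)))%E.
Proof.
under eq_integral do rewrite space_integralE.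
by apply: integralB => //; [exact: time_integrable_pos|exact: time_integrable_neg].
Qed.

End domination.

Section kernels_in_time.
Context d' (Y : measurableType d') (theta : probability Y R) (N : R -> Y -> P)
  (D : set R) (f : R * borel Rd -> \bar R).
Hypotheses (mN : forall B : set (borel Rd), measurable B ->
              measurable_fun [set: R * Y] (fun z => N z.1 z.2 B))
  (mD : measurable D) (mf : measurable_fun [set: R * borel Rd] f)
  (f0 : forall z, (0 <= f z)%E).

Let F (z : R * Y) : \bar R := (\int[N z.1 z.2]_x f (z.1, x) * (\1_D z.1)%:E)%E.

Let F0 z : (0 <= F z)%E.
Proof. by rewrite mule_ge0 ?integral_ge0 ?lee_fin. Qed.

Let mF : measurable_fun [set: R * Y] F.
Proof.
apply: emeasurable_funM.
  apply: (@measurable_kernel_integral _ _ _ _ (fun z => N z.1 z.2)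
    (fun w => f (w.1.1, w.2))) => //.
  apply: (measurableT_comp mf); apply: measurable_fun_pair => //=.
  by apply: (measurableT_comp measurable_fst); exact: measurable_fst.
apply/measurable_EFinP; apply: (measurableT_comp (measurable_indic mD)).
exact: measurable_fst.
Qed.

Let FE y : (\int[leb]_(u in D) \int[N u y]_x f (u, x) = \int[leb]_u F (u, y))%E.
Proof. by rewrite integral_mkcond epatch_indic. Qed.

Lemma measurable_time_integral :
  measurable_fun [set: Y] (fun y => \int[leb]_(u in D) \int[N u y]_x f (u, x))%E.
Proof.
under eq_fun do rewrite FE.
exact: (@measurable_fun_fubini_tonelli_G _ _ _ _ _ leb F mF F0).
Qed.

(** Tonelli's theorem, [K u] being the mixture of the [N u y] under [theta]. *)
Lemma time_integral_mixture (K : R -> P) :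
  (forall u (h : borel Rd -> \bar R), measurable_fun [set: borel Rd] h ->
    (forall x, (0 <= h x)%E) ->
    (\int[K u]_x h x = \int[theta]_y \int[N u y]_x h x)%E) ->
  (\int[leb]_(u in D) \int[K u]_x f (u, x) =
   \int[theta]_y \int[leb]_(u in D) \int[N u y]_x f (u, x))%E.
Proof.
move=> KN; have mfx u : measurable_fun [set: borel Rd] (fun x => f (u, x)).
  by apply: (measurableT_comp mf); exact: pair1_measurable.
under [RHS]eq_integral do rewrite FE.
rewrite -(@fubini_tonelli _ _ _ _ _ leb theta F mF F0).
rewrite integral_mkcond epatch_indic; apply: eq_integral => u _ /=.
rewrite KN// /F/= ge0_integralZr//.
  apply: (@measurable_kernel_integral _ _ _ _ (N u) (fun w => f (u, w.2))) => //.
    by move=> B mB; exact: (measurableT_comp (mN mB) (@pair1_measurable _ _ R Y u)).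
  by apply: (measurableT_comp (mfx u)); exact: measurable_snd.
by move=> y _; exact: integral_ge0.
Qed.

End kernels_in_time.

End TimeIntegrals.

(** * Solutions along a given path of measures *)

Section LinearEvolution.
Context (R : realType) (d m : nat).
Local Notation Rd := 'rV[R]_d.
Local Notation P := (Prob R d).
Local Notation leb := (@lebesgue_measure R).
Variables (b : R -> Rd -> P -> Rd) (sigma : R -> Rd -> P -> 'M[R]_(d, m)).
Hypotheses (mb : borel_coef b) (msigma : borel_coef sigma).

(** Well-posedness determines measures up to [meq] only; Borel coefficients do not
    see the difference. *)
Lemma FP_solution_meq (s : R) (M M' nu : R -> P) : 0 <= s ->
  (forall t, s <= t -> meq (M t) (M' t)) ->
  FP_solution b sigma s M nu -> FP_solution b sigma s M' nu.
Proof.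
move=> s0 MM' [cnu fnu enu].
have bE r x : s <= r -> b r x (M r) = b r x (M' r).
  by move=> sr; apply: indistinguishable_coef; [|exact: le_trans sr|exact: MM'].
have sE r x : s <= r -> sigma r x (M r) = sigma r x (M' r).
  by move=> sr; apply: indistinguishable_coef; [|exact: le_trans sr|exact: MM'].
split; first exact: cnu.
- move=> t st.
  apply: le_lt_trans (fnu t st); rewrite le_eqVlt; apply/orP; left; apply/eqP.
  apply: eq_integral => r; rewrite inE/= in_itv/= => /andP[sr _].
  by apply: eq_integral => x _; rewrite bE// sE.
- move=> t h st th; apply: (etrans (enu t h st th)); apply: (congr1 (adde _)).
  apply: eq_integral => r; rewrite inE/= in_itv/= => /andP[sr _].
  by apply: eq_integral => x _; rewrite /generator bE// sE.
Qed.

Definition stopped_cost (s : R) (M : R -> P) (z : R * borel Rd) : R :=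
  cost b sigma (Num.max z.1 s) (M (Num.max z.1 s)) z.2.

Definition stopped_generator (s : R) (M : R -> P) h (z : R * borel Rd) : R :=
  generator b sigma (Num.max z.1 s) (M (Num.max z.1 s)) h z.2.

Lemma stopped_cost_ge0 s M z : 0 <= stopped_cost s M z.
Proof. exact: cost_ge0. Qed.

Section AlongPath.
Variables (s : R) (M : R -> P).
Hypotheses (s0 : 0 <= s) (cM : {within `[s, +oo[%classic, continuous M}).
Local Notation c := (stopped_cost s M).
Local Notation g := (stopped_generator s M).

Lemma measurable_stopped_cost : measurable_fun [set: R * borel Rd] c.
Proof. exact: (measurable_cost mb msigma s0 (continuous_stopped cM)). Qed.

Lemma measurable_stopped_generator h : test_function h ->
  measurable_fun [set: R * borel Rd] (g h).
Proof. exact: (measurable_generator mb msigma s0 (continuous_stopped cM)). Qed.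

Lemma stopped_integral (nu : R -> P) (t r : R) (f : R -> Rd -> P -> \bar R) : s <= r ->
  (\int[leb]_(u in `[r, t]) \int[nu u]_x f u x (M u) =
   \int[leb]_(u in `[r, t]) \int[nu (Num.max u s)]_x
      f (Num.max u s) x (M (Num.max u s)))%E.
Proof.
move=> sr; apply: eq_integral => u; rewrite inE/= in_itv/= => /andP[ru _].
by rewrite max_l// (le_trans sr).
Qed.

Lemma FP_solution_stopped (nu : R -> P) :
  FP_solution b sigma s M nu <->
  [/\ {within `[s, +oo[%classic, continuous nu},
      forall t, s <= t ->
        (\int[leb]_(u in `[s, t]) \int[nu (Num.max u s)]_x (c (u, x))%:E < +oo)%E &
      forall t h, s <= t -> test_function h ->
        (\int[nu t]_x (h x)%:E = \int[nu s]_x (h x)%:E +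
         \int[leb]_(u in `[s, t]) \int[nu (Num.max u s)]_x (g h (u, x))%:E)%E].
Proof.
split=> -[cnu fnu enu]; (split; first exact: cnu).
- move=> t st; have := fnu t st.
  by rewrite (@stopped_integral nu t s (fun u x p => (cost b sigma u p x)%:E)).
- move=> t h st th; rewrite (enu t h st th).
  by rewrite (@stopped_integral nu t s
    (fun u x p => (generator b sigma u p h x)%:E)).
- move=> t st; have := fnu t st.
  by rewrite -(@stopped_integral nu t s (fun u x p => (cost b sigma u p x)%:E)).
- move=> t h st th; rewrite (enu t h st th).
  by rewrite -(@stopped_integral nu t s
    (fun u x p => (generator b sigma u p h x)%:E)).
Qed.

(** Solutions can be restarted at a later time [r]. Subtracting the equations at
    [r] and [t] amounts to cutting the time integral at [r]. *)
Lemma FP_solution_restrict (nu : R -> P) (r : R) : s <= r ->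
  FP_solution b sigma s M nu -> FP_solution b sigma r M nu.
Proof.
move=> sr sol; have [cnu _ _] := sol.
have /FP_solution_stopped[_ fnu enu] := sol.
have mN := measurable_path_eval (continuous_stopped cnu).
have mc := measurable_stopped_cost.
have c0 z : 0 <= c z by exact: stopped_cost_ge0.
have mcN : measurable_fun [set: R]
    (fun u => \int[nu (Num.max u s)]_x (c (u, x))%:E)%E.
  have mcE : measurable_fun [set: R * borel Rd] (EFin \o c).
    exact/measurable_EFinP.
  apply: (measurable_kernel_integral mN _ mcE).
  by move=> z; rewrite lee_fin.
split.
- apply: continuous_subspaceW cnu.
  by move=> u /=; rewrite !in_itv/= !andbT; exact: le_trans.
- move=> t rt; have st := le_trans sr rt.
  rewrite (@stopped_integral nu t r (fun u x p => (cost b sigma u p x)%:E))//.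
  apply: le_lt_trans (fnu t st); apply: ge0_subset_integral => //.
  + exact: measurable_funTS mcN.
  + move=> u _; apply: integral_ge0 => x _; rewrite lee_fin.
    exact: cost_ge0.
  + by move=> u /=; rewrite !in_itv/= => /andP[ru ->]; rewrite (le_trans sr ru).
- move=> t h rt th; have st := le_trans sr rt.
  have [C C0 gC] := generator_bounded b sigma th.
  have gint := time_integrable mN mc (measurable_stopped_generator th) c0 C0
    (fun z => gC _ _ _) (measurable_itv _) (fnu t st).
  rewrite (enu t h st th) (enu r h sr th).
  rewrite (@stopped_integral nu t r
    (fun u x p => (generator b sigma u p h x)%:E))//.
  rewrite -addeA; congr (_ + _)%E.
  have mphi := measurable_int leb gint.
  rewrite (@itv_bndbnd_setU _ R (BLeft s) (BRight r) (BRight t)) ?bnd_simp//.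
  rewrite integral_setU//; last 2 first.
  + by rewrite -itv_bndbnd_setU ?bnd_simp.
  + apply/disj_setPRL => u /=; rewrite !in_itv/= => /andP[ru _] /andP[_].
    by rewrite leNgt ru.
  congr (_ + _)%E; rewrite integral_itv_obnd_cbnd//.
  apply: measurable_funS mphi => // u /=; rewrite !in_itv/= => /andP[ru ->].
  by rewrite andbT (le_trans sr)// ltW.
Qed.

End AlongPath.
End LinearEvolution.

(** * Mixtures and signed bounded functions *)

Section BoundedMixture.
Context (R : realType) (d : nat).
Local Notation Rd := 'rV[R]_d.
Local Notation P := (Prob R d).

Lemma bounded_integral_le (p : P) (f : borel Rd -> R) (C : R) :
  measurable_fun [set: borel Rd] f -> (forall x, 0 <= f x <= C) ->
  (0 <= \int[p]_x (f x)%:E <= C%:E)%E.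
Proof.
move=> mf fC; apply/andP; split.
  by apply: integral_ge0 => x _; rewrite lee_fin; case/andP: (fC x).
have pT : p [set: borel Rd] = 1%E by exact: probability_setT.
rewrite -[leRHS]mule1 -pT -(integral_cst p measurableT); apply: ge0_le_integral => //.
- by move=> x _; rewrite lee_fin; case/andP: (fC x).
- exact/measurable_EFinP.
- by move=> x _; rewrite lee_fin; case/andP: (fC x).
Qed.

Lemma cb_int_bounded (p : P) (f : Cb R d) (C : R) :
  (forall x, `|sval f x| <= C) ->
  `|cb_int f p| <= C.
Proof.
move=> fC; have mf : measurable_fun [set: borel Rd] (sval f : borel Rd -> R).
  by apply: continuous_measurable_rV; have [] := svalP f.
rewrite -lee_fin -abse_EFin cb_intE.
apply: le_trans (le_abse_integral p measurableT _) _; first exact/measurable_EFinP.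
have nf x : 0 <= `|sval f x| <= C by rewrite normr_ge0 fC.
have mnf := measurableT_comp (@normr_measurable R setT) mf.
by have /andP[_] := bounded_integral_le p mnf nf.
Qed.

Lemma probability_bounded_integrable d' (Y : measurableType d')
    (theta : probability Y R) (f : Y -> \bar R) (C : R) : measurable_fun [set: Y] f ->
  (forall y, (`|f y| <= C%:E)%E) -> theta.-integrable [set: Y] f.
Proof.
move=> mf fC; apply: (@le_integrable _ _ _ theta _ _ _ (cst C%:E)) => //.
  move=> y _ /=; apply: le_trans (fC y) _; rewrite lee_fin; exact: ler_norm.
exact: finite_measure_integrable_cst.
Qed.

Section mixture_bounded.
Context d' (Y : measurableType d') (theta : probability Y R) (k : Y -> P) (p : P).
Hypothesis mk : forall B : set (borel Rd), measurable B ->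
  measurable_fun [set: Y] (fun y => k y B).
Hypothesis kp : forall f : borel Rd -> \bar R,
  measurable_fun [set: borel Rd] f -> (forall x, (0 <= f x)%E) ->
  (\int[p]_x f x = \int[theta]_y \int[k y]_x f x)%E.

Let mint (f : borel Rd -> \bar R) : measurable_fun [set: borel Rd] f ->
  (forall x, (0 <= f x)%E) -> measurable_fun [set: Y] (fun y => \int[k y]_x f x)%E.
Proof. by move=> mf f0; exact: (measurable_fun_integral_kernel mk). Qed.

Lemma mixture_bounded (f : borel Rd -> R) (C : R) :
  measurable_fun [set: borel Rd] f -> (forall x, `|f x| <= C) ->
  [/\ measurable_fun [set: Y] (fun y => \int[k y]_x (f x)%:E)%E,
      theta.-integrable [set: Y] (fun y => \int[k y]_x (f x)%:E)%E &
      (\int[p]_x (f x)%:E = \int[theta]_y \int[k y]_x (f x)%:E)%E].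
Proof.
move=> mf fC.
have C0 : 0 <= C by apply: le_trans (normr_ge0 _) (fC point).
pose fp x := Num.max (f x) 0; pose fm x := Num.max (- f x) 0.
have mfp : measurable_fun [set: borel Rd] fp.
  by apply: measurable_maxr => //; exact: measurable_cst.
have mfm : measurable_fun [set: borel Rd] fm.
  apply: measurable_maxr; last exact: measurable_cst.
  exact: measurableT_comp.
have fpE : ((EFin \o f)^\+)%E = EFin \o fp.
  by apply/funext => x; rewrite funeposE /= /fp EFin_max.
have fmE : ((EFin \o f)^\-)%E = EFin \o fm.
  by apply/funext => x; rewrite funenegE /= /fm EFin_max.
have fp0 x : 0 <= fp x by rewrite le_max lexx orbT.
have fm0 x : 0 <= fm x by rewrite le_max lexx orbT.
have fpC x : 0 <= fp x <= C.
  by rewrite fp0 ge_max C0 andbT (le_trans (ler_norm _)).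
have fmC x : 0 <= fm x <= C.
  by rewrite fm0 ge_max C0 andbT (le_trans (ler_norm _))// normrN.
have intE (q : P) :
    (\int[q]_x (f x)%:E = \int[q]_x (fp x)%:E - \int[q]_x (fm x)%:E)%E.
  by rewrite integralE -/(EFin \o f) fpE fmE.
have mp : measurable_fun [set: Y] (fun y => \int[k y]_x (fp x)%:E)%E.
  by apply: mint => [|x]; [exact/measurable_EFinP|rewrite lee_fin].
have mm : measurable_fun [set: Y] (fun y => \int[k y]_x (fm x)%:E)%E.
  by apply: mint => [|x]; [exact/measurable_EFinP|rewrite lee_fin].
have ip : theta.-integrable [set: Y] (fun y => \int[k y]_x (fp x)%:E)%E.
  apply: (@probability_bounded_integrable _ _ _ _ C) => // y.
  by have /andP[i0 iC] := bounded_integral_le (k y) mfp fpC; rewrite gee0_abs.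
have im : theta.-integrable [set: Y] (fun y => \int[k y]_x (fm x)%:E)%E.
  apply: (@probability_bounded_integrable _ _ _ _ C) => // y.
  by have /andP[i0 iC] := bounded_integral_le (k y) mfm fmC; rewrite gee0_abs.
split.
- under eq_fun do rewrite intE.
  exact: emeasurable_funB.
- under eq_fun do rewrite intE.
  by apply: integrableB.
- rewrite intE; under [RHS]eq_integral do rewrite intE.
  rewrite (kp (f := EFin \o fp)); last 2 first.
    exact/measurable_EFinP.
    by move=> x; rewrite lee_fin.
  rewrite (kp (f := EFin \o fm)); last 2 first.
    exact/measurable_EFinP.
    by move=> x; rewrite lee_fin.
  by rewrite [RHS]integralB.
Qed.

End mixture_bounded.
End BoundedMixture.

(** * Superposition of solutions *)

Section Superposition.
Context (R : realType) (d m : nat).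
Local Notation Rd := 'rV[R]_d.
Local Notation P := (Prob R d).
Local Notation leb := (@lebesgue_measure R).
Variables (b : R -> Rd -> P -> Rd) (sigma : R -> Rd -> P -> 'M[R]_(d, m)).
Hypotheses (mb : borel_coef b) (msigma : borel_coef sigma).
Variables (s : R) (M : R -> P).
Hypotheses (s0 : 0 <= s) (cM : {within `[s, +oo[%classic, continuous M}).
Local Notation c := (stopped_cost b sigma s M).
Local Notation g := (stopped_generator b sigma s M).
Variables (d' : measure_display) (Y : measurableType d') (theta : probability Y R).
Variable nu : Y -> R -> P.
Hypothesis sol : forall y, FP_solution b sigma s M (nu y).
Hypothesis mnu : forall t (f : Cb R d), s <= t ->
  measurable_fun [set: Y] (fun y => cb_int f (nu y t)).
Local Notation N := (fun u y => nu y (Num.max u s)).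

Lemma continuous_stopped_family y : continuous (N ^~ y).
Proof. by apply: continuous_stopped; have [] := sol y. Qed.

Lemma measurable_stopped_family B : measurable (B : set (borel Rd)) ->
  measurable_fun [set: R * Y] (fun z => N z.1 z.2 B).
Proof.
apply: measurable_eval => // f.
apply: (@measurable_caratheodory _ _ _ (fun u y => cb_int f (N u y))).
  by move=> y; have /continuous_ProbP := @continuous_stopped_family y; apply.
by move=> u; apply: mnu; rewrite le_max lexx orbT.
Qed.

Lemma measurable_stopped_family_at u B : measurable (B : set (borel Rd)) ->
  measurable_fun [set: Y] (fun y => N u y B).
Proof.
move=> mB.
exact: (measurableT_comp (measurable_stopped_family mB)
  (@pair1_measurable _ _ R Y u)).
Qed.

Let cE0 z : (0 <= (EFin \o c) z)%E.
Proof. by rewrite lee_fin; exact: stopped_cost_ge0. Qed.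

Let mcE : measurable_fun [set: R * borel Rd] (EFin \o c).
Proof. by apply/measurable_EFinP; exact: measurable_stopped_cost. Qed.

Hypothesis cost_fin : forall t, s <= t ->
  (\int[theta]_y \int[leb]_(u in `[s, t]) \int[N u y]_x (c (u, x))%:E < +oo)%E.

(** The equation is linear in [nu], so it can be integrated in [y]; what has to be
    justified is Fubini's theorem, hence the hypothesis [cost_fin]. *)
Theorem FP_superposition : exists2 K : R -> P, FP_solution b sigma s M K &
  forall t B, s <= t -> measurable (B : set (borel Rd)) ->
    K t B = (\int[theta]_y nu y t B)%E.
Proof.
have /choice[K KN] : forall u, exists p : P, forall f : borel Rd -> \bar R,
    measurable_fun [set: borel Rd] f -> (forall x, (0 <= f x)%E) ->
    (\int[p]_x f x = \int[theta]_y \int[N u y]_x f x)%E.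
  by move=> u; apply: mixture_exists => B mB; exact: measurable_stopped_family_at.
have cK : continuous K.
  apply/continuous_ProbP => f u; have [_ [C fC]] := svalP f.
  have mf : measurable_fun [set: borel Rd] (sval f : borel Rd -> R).
    by apply: continuous_measurable_rV; have [] := svalP f.
  have KE v : cb_int f (K v) = (\int[theta]_y cb_int f (N v y))%R.
    have [_ _] := mixture_bounded (@measurable_stopped_family_at v) (KN v) mf fC.
    rewrite /cb_int /Rintegral => ->; congr fine; apply: eq_integral => y _.
    by rewrite -cb_intE.
  have bN v y : `|cb_int f (N v y)| <= C.
    exact: cb_int_bounded.
  have -> : cb_int f \o K = fun v => (\int[theta]_y cb_int f (N v y))%R.
    by apply/funext => v; exact: KE.
  have uI : u \in (`]u - 1, u + 1[%classic : set R).
    by rewrite inE/= in_itv/= ltrBlDr ltrDl ltr01.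
  have int_N v : theta.-integrable [set: Y] (EFin \o (fun y => cb_int f (N v y))).
    apply: (@probability_bounded_integrable _ _ _ _ _ C).
      by apply/measurable_EFinP; apply: mnu; rewrite le_max lexx orbT.
    by move=> y; rewrite lee_fin.
  apply: (@continuity_under_integral R _ Y theta (fun v y => cb_int f (N v y))
    setT measurableT (u - 1) (u + 1) _ _ (cst C) _ _ u uI).
  + by move=> v _.
  + apply: aeW => y _ v _.
    by have /continuous_ProbP := @continuous_stopped_family y; apply.
  + exact: finite_measure_integrable_cst.
  + by move=> v _; apply: aeW => y _; exact: bN.
have KN' u (h : borel Rd -> \bar R) : measurable_fun [set: borel Rd] h ->
    (forall x, (0 <= h x)%E) ->
    (\int[K (Num.max u s)]_x h x = \int[theta]_y \int[N u y]_x h x)%E.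
  move=> mh h0; rewrite (KN _ _ mh h0); apply: eq_integral => y _.
  by rewrite (max_l (x := Num.max u s))// le_max lexx orbT.
exists K; last first.
  move=> t B st mB.
  have mB1 : measurable_fun [set: borel Rd] (EFin \o (\1_B : borel Rd -> R)).
    by apply/measurable_EFinP; exact: measurable_indic.
  have -> : K t B = (\int[K t]_x (\1_B x)%:E)%E.
    by rewrite integral_indic// setIT.
  rewrite (KN t (EFin \o \1_B) mB1); last by move=> x; rewrite lee_fin.
  rewrite max_l//; apply: eq_integral => y _.
  by rewrite integral_indic// setIT.
have tint t0 (f : R * borel Rd -> \bar R) :
    measurable_fun [set: R * borel Rd] f -> (forall z, (0 <= f z)%E) ->
    (\int[leb]_(u in `[s, t0]) \int[K (Num.max u s)]_x f (u, x) =
     \int[theta]_y \int[leb]_(u in `[s, t0]) \int[N u y]_x f (u, x))%E.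
  move=> mf f0.
  exact: (@time_integral_mixture R d _ Y theta N `[s, t0]%classic f
    measurable_stopped_family (measurable_itv _) mf f0 (fun u => K (Num.max u s)) KN').
have costK : forall t, s <= t ->
    (\int[leb]_(u in `[s, t]) \int[K (Num.max u s)]_x (c (u, x))%:E < +oo)%E.
  by move=> t st; rewrite (tint t _ mcE cE0); exact: cost_fin.
apply/FP_solution_stopped; split.
- exact: continuous_subspaceT.
- exact: costK.
move=> t h st th.
have [C C0 gC] := generator_bounded b sigma th.
have [Ch _ hC] := iter_partial_bounded [::] th.
have mh := partial_measurable [::] th.
have mg := measurable_stopped_generator mb msigma s0 cM th.
have mc := measurable_stopped_cost mb msigma s0 cM.
have c0 := stopped_cost_ge0 b sigma s M.
have gC' z : `|g h z| <= C * c z by exact: gC.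
have mK := measurable_path_eval (continuous_stopped
  (continuous_subspaceT (A := `[s, +oo[%classic) cK)).
have [mh0 ih0 hs] := mixture_bounded (@measurable_stopped_family_at s) (KN s) mh hC.
have [_ _ ht] := mixture_bounded (@measurable_stopped_family_at t) (KN t) mh hC.
have mgp := measurable_pos_part mg; have mgm := measurable_neg_part mg.
have gp0 z : (0 <= (EFin \o g h)^\+%E z)%E by exact: funepos_ge0.
have gm0 z : (0 <= (EFin \o g h)^\-%E z)%E by exact: funeneg_ge0.
have mIp := measurable_time_integral measurable_stopped_family
  (measurable_itv `[s, t]) mgp gp0.
have mIm := measurable_time_integral measurable_stopped_family
  (measurable_itv `[s, t]) mgm gm0.
have Ip := tint t _ mgp gp0; have Im := tint t _ mgm gm0.
have fin_int (f : Y -> \bar R) :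
    measurable_fun [set: Y] f -> (forall y, (0 <= f y)%E) ->
    (\int[theta]_y f y < +oo)%E -> theta.-integrable [set: Y] f.
  move=> mf f0 ffin; apply/integrableP; split => //.
  by under eq_integral do rewrite gee0_abs//.
have iIp : theta.-integrable [set: Y]
    (fun y => \int[leb]_(u in `[s, t]) \int[N u y]_x ((EFin \o g h)^\+ (u, x)))%E.
  apply: fin_int => //.
    by move=> y; apply: integral_ge0 => u _; apply: integral_ge0 => x _.
  rewrite -Ip; apply: integrable_lty => //.
  exact: (time_integrable_pos mK mc mg c0 C0 gC' (measurable_itv _)
    (costK t st)).
have iIm : theta.-integrable [set: Y]
    (fun y => \int[leb]_(u in `[s, t]) \int[N u y]_x ((EFin \o g h)^\- (u, x)))%E.
  apply: fin_int => //.
    by move=> y; apply: integral_ge0 => u _; apply: integral_ge0 => x _.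
  rewrite -Im; apply: integrable_lty => //.
  exact: (time_integrable_neg mK mc mg c0 C0 gC' (measurable_itv _) (costK t st)).
rewrite (time_integralE mK mc mg c0 C0 gC' (measurable_itv _) (costK t st)) Ip Im.
rewrite -(integralB measurableT iIp iIm) hs ht -(integralD measurableT ih0); last first.
  exact: integrableB.
apply: eq_integral => y _; rewrite !max_l//.
have /FP_solution_stopped[cy fy ey] := sol y.
rewrite (ey t h st th); congr (_ + _)%E.
have mNy := measurable_path_eval (@continuous_stopped_family y).
exact: (time_integralE mNy mc mg c0 C0 gC' (measurable_itv _) (fy t st)).
Qed.

End Superposition.

(** * Restricting probability measures to large sets *)

Section LargeSets.
Context d' (T : measurableType d') (R : realType) (theta : probability T R).

(** Each [G k] exceeds a large constant [n k] only on a set of measure at most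
    [e / 2 ^ k.+1]; [A] is the complement of the union of these sets. *)
Lemma uniform_bound_large_set (G : nat -> T -> \bar R) (e : R) : 0 < e ->
  (forall k, measurable_fun [set: T] (G k)) -> (forall k x, (G k x < +oo)%E) ->
  exists A, exists n : nat -> nat, [/\ measurable A, (theta (~` A) <= e%:E)%E &
    forall k x, A x -> (G k x <= (n k)%:R%:E)%E].
Proof.
move=> e0 mG Gfin.
pose F k n := [set x | (n%:R%:E < G k x)%E].
have mF k n : measurable (F k n).
  by rewrite /F -[X in measurable X]setTI; exact: emeasurable_fun_o_infty.
have /choice[n nP] : forall k, exists n, (theta (F k n) <= (e / (2 ^ k.+1)%:R)%:E)%E.
  move=> k; have F0 : \bigcap_n F k n = set0.
    rewrite -subset0 => x Fx; have := Gfin k x; rewrite ltNge => /negP; apply.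
    have [r Gr] : exists r, G k x = r%:E \/ G k x = +oo%E.
      have := Fx 0%N I; rewrite /F/=; case: (G k x) => [r _|_|//].
        by exists r; left.
      by exists 0; right.
    case: Gr => [Gr|->//]; exfalso.
    have := Fx (Num.truncn `|r|).+1 I; rewrite /F/= Gr lte_fin ltNge => /negP; apply.
    by rewrite (le_trans (ler_norm r))// ltW// truncnS_gt.
  have : theta (F k n) @[n --> \oo] --> theta (\bigcap_n F k n).
    apply: nonincreasing_cvg_mu => //.
    - by apply: le_lt_trans (ltry 1); exact: probability_le1.
    - exact: bigcap_measurable.
    - move=> a b ab; apply/subsetPset => x; rewrite /F/=; apply: le_lt_trans.
      by rewrite lee_fin ler_nat.
  have d0 : 0 < e / (2 ^ k.+1)%:R by rewrite divr_gt0// ltr0n expn_gt0.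
  rewrite F0 measure0 => /fine_cvgP[Ffin /cvgrPdist_lt/(_ _ d0) Fd].
  have [n [/= Fn_fin]] := filter_ex (filterI Ffin Fd).
  rewrite sub0r normrN => Fn; exists n.
  by rewrite -(fineK Fn_fin) lee_fin (le_trans (ler_norm _))// ltW.
have mFn : measurable (\bigcup_k F k (n k)) by exact: bigcup_measurable.
exists (~` \bigcup_k F k (n k)); exists n; split.
- exact: measurableC.
- rewrite setCK; apply: (@le_trans _ _ (\sum_(0 <= k <oo) theta (F k (n k)))%E).
    by apply: measure_sigma_subadditive => // k; exact: mF.
  apply: le_trans (epsilon_trick0 xpredT (ltW e0)).
  exact: lee_nneseries.
- move=> k x nFx; rewrite leNgt; apply/negP => Gx; apply: nFx.
  by exists k.
Qed.

Lemma ge0_integral_if (A : set T) (f1 f2 : T -> \bar R) : measurable A ->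
  measurable_fun [set: T] f1 -> measurable_fun [set: T] f2 ->
  (forall x, (0 <= f1 x)%E) -> (forall x, (0 <= f2 x)%E) ->
  (\int[theta]_x (if x \in A then f1 x else f2 x) =
   \int[theta]_(x in A) f1 x + \int[theta]_(x in ~` A) f2 x)%E.
Proof.
move=> mA m1 m2 f10 f20; rewrite -(setUv A) ge0_integral_setU//.
- congr (_ + _)%E; apply: eq_integral => x; rewrite inE => Ax.
    by rewrite mem_set.
  by rewrite memNset.
- exact: measurableC.
- rewrite setUv; apply: measurable_fun_ifT => //.
  by apply: (measurable_fun_bool true); rewrite setTI /preimage/= set_mem_set.
- by move=> x _; case: ifP.
- by apply/disj_setPCl.
Qed.

(** [q] is [theta] conditioned on [D]; when [D] is null any [q] will do. *)
Lemma conditional_exists (D : set T) : measurable D ->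
  exists q : probability T R, forall B, measurable B ->
    (theta D * q B = theta (B `&` D))%E.
Proof.
move=> mD; exists (mnormalize (mrestr theta mD) theta) => B mB.
have tD : theta D \is a fin_num by exact: fin_num_measure.
have BD : (theta (B `&` D) <= theta D)%E.
  by apply: le_measure; rewrite ?inE//; exact: measurableI.
rewrite -[X in (_ * X)%E]/(mnormalize (mrestr theta mD) theta B) /mnormalize.
rewrite [X in fine X](_ : _ = theta D); last exact: (congr1 theta (setTI D)).
rewrite [X in (X == 0)%E](_ : _ = theta D); last exact: (congr1 theta (setTI D)).
rewrite [X in (X == +oo)%E](_ : _ = theta D); last exact: (congr1 theta (setTI D)).
case: ifPn => [/orP[/eqP D0|/eqP Doo]|].
- by rewrite D0 mul0e; apply/esym/eqP; rewrite -measure_le0 -D0.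
- by rewrite Doo in tD.
rewrite negb_or => /andP[D0 _].
rewrite /mrestr muleCA -{1}(fineK tD) -EFinM divff ?mule1//.
by apply: contra D0 => /eqP D0; rewrite -(fineK tD) D0.
Qed.

End LargeSets.

(** * Disintegration along the initial value *)

Section Disintegration.
Context (R : realType) (d m : nat).
Local Notation Rd := 'rV[R]_d.
Local Notation P := (Prob R d).
Local Notation leb := (@lebesgue_measure R).
Variables (b : R -> Rd -> P -> Rd) (sigma : R -> Rd -> P -> 'M[R]_(d, m)).
Hypotheses (mb : borel_coef b) (msigma : borel_coef sigma).
Variables (s : R) (M : R -> P).
Hypotheses (s0 : 0 <= s) (cM : {within `[s, +oo[%classic, continuous M}).
Variable S : P -> R -> P.
Hypothesis S_sol : forall theta, FP_solution b sigma s M (S theta).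
Hypothesis S_init : forall theta, meq (S theta s) theta.
Hypothesis S_unique : forall theta nu, FP_solution b sigma s M nu ->
  meq (nu s) theta -> forall t, s <= t -> meq (nu t) (S theta t).
Hypothesis mS : forall t (f : Cb R d), s <= t ->
  measurable_fun [set: borel Rd] (fun y : borel Rd => cb_int f (S (dirac_prob y) t)).
Local Notation c := (stopped_cost b sigma s M).

Let cE0 z : (0 <= (EFin \o c) z)%E.
Proof. by rewrite lee_fin; exact: stopped_cost_ge0. Qed.

Let mcE : measurable_fun [set: R * borel Rd] (EFin \o c).
Proof. by apply/measurable_EFinP; exact: measurable_stopped_cost. Qed.

Let total (t : R) (nu : R -> P) : \bar R :=
  (\int[leb]_(u in `[s, t]) \int[nu (Num.max u s)]_x (c (u, x))%:E)%E.

Let total_ge0 t nu : (0 <= total t nu)%E.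
Proof. by apply: integral_ge0 => u _; apply: integral_ge0 => x _; exact: cE0. Qed.

Let total_fin t nu : s <= t -> FP_solution b sigma s M nu -> (total t nu < +oo)%E.
Proof. by move=> st /FP_solution_stopped[_ + _]; apply. Qed.

Let measurable_total d' (Y : measurableType d') (nu : Y -> R -> P) t :
  (forall y, FP_solution b sigma s M (nu y)) ->
  (forall t (f : Cb R d), s <= t ->
    measurable_fun [set: Y] (fun y => cb_int f (nu y t))) ->
  measurable_fun [set: Y] (fun y => total t (nu y)).
Proof.
move=> sol mnu.
exact: (measurable_time_integral (measurable_stopped_family sol mnu)
  (measurable_itv `[s, t]) mcE cE0).
Qed.

Let total_mono t t' nu : FP_solution b sigma s M nu -> s <= t -> t <= t' ->
  (total t nu <= total t' nu)%E.
Proof.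
move=> sol st tt'; apply: ge0_subset_integral => //.
- apply: measurable_funTS.
  have [cnu _ _] := sol.
  have mN := measurable_path_eval (continuous_stopped cnu).
  exact: (measurable_kernel_integral mN cE0 mcE).
- by move=> u _; apply: integral_ge0 => x _; exact: cE0.
- by move=> u /=; rewrite !in_itv/= => /andP[-> ut]; rewrite (le_trans ut tt').
Qed.

Lemma measurable_S_eval t B : s <= t -> measurable (B : set (borel Rd)) ->
  measurable_fun [set: borel Rd] (fun y : borel Rd => S (dirac_prob y) t B).
Proof. by move=> st; apply: measurable_eval => // f; exact: mS. Qed.

(** The paths [S (dirac_prob y)] need not have a [theta]-integrable cost, so they
    cannot be superposed at once. Let [A] be a set of nearly full measure on
    which their costs are bounded, up to each time [s + k]. Superposing
    [S (dirac_prob y)] for [y] in [A] with the single path [S q] for [y] outside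
    of [A], where [q] is [theta] conditioned on the complement of [A], keeps the
    costs integrable and gives a solution started at [theta], which is [S theta]
    by uniqueness. The error caused by [S q] is at most [theta (~` A)]. *)
Theorem solution_disintegration theta t B :
  s <= t -> measurable (B : set (borel Rd)) ->
  S theta t B = (\int[theta]_y S (dirac_prob y) t B)%E.
Proof.
move=> st mB.
have approx (e : R) : 0 < e -> exists A : set (borel Rd), exists q : P,
    [/\ measurable A, (theta (~` A) <= e%:E)%E &
     S theta t B = (\int[theta]_(y in A) S (dirac_prob y) t B +
       \int[theta]_(y in ~` A) S q t B)%E].
  move=> e0.
  pose G (k : nat) (y : borel Rd) := total (s + k%:R) (S (dirac_prob y)).
  have sk k : s <= s + k%:R by rewrite lerDl.
  have mG k : measurable_fun [set: borel Rd] (G k).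
    by apply: measurable_total.
  have Gfin k y : (G k y < +oo)%E by exact: total_fin.
  have [A [n [mA tA GA]]] := uniform_bound_large_set theta e0 mG Gfin.
  have [q qE] := conditional_exists theta (measurableC mA).
  exists A; exists q; split => //.
  pose nu (y : borel Rd) := if y \in A then S (dirac_prob y) else S q.
  have sol y : FP_solution b sigma s M (nu y) by rewrite /nu; case: ifP.
  have mbA : measurable_fun [set: borel Rd] (fun y => y \in A).
    by apply: (measurable_fun_bool true); rewrite setTI /preimage/= set_mem_set.
  have mnu t0 (f : Cb R d) : s <= t0 ->
      measurable_fun [set: borel Rd] (fun y => cb_int f (nu y t0)).
    move=> st0; have -> : (fun y => cb_int f (nu y t0)) =
        (fun y => if y \in A then cb_int f (S (dirac_prob y) t0)
                  else cb_int f (S q t0)).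
      by apply/funext => y; rewrite /nu; case: ifP.
    by apply: measurable_fun_ifT => //; exact: mS.
  have cost_fin t0 : s <= t0 -> (\int[theta]_y total t0 (nu y) < +oo)%E.
    move=> st0; pose k := (Num.truncn (t0 - s)).+1.
    have t0k : t0 <= s + k%:R by rewrite -lerBlDl ltW// truncnS_gt.
    pose C := maxe (n k)%:R%:E (total (s + k%:R) (S q)).
    have Cfin : (C < +oo)%E by rewrite gt_max ltry total_fin.
    apply: (@le_lt_trans _ _ (\int[theta]_y C)%E); last first.
      rewrite integral_cst// [X in (_ * X)%E](_ : _ = 1%E) ?mule1//.
      exact: probability_setT.
    apply: ge0_le_integral => //.
    + exact: measurable_total.
    + move=> y _; apply: le_trans (total_mono (sol y) st0 t0k) _.
      rewrite le_max /nu; case: ifPn => yA; apply/orP; [left|right] => //.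
      by apply: GA; rewrite inE in yA.
  have [K Ksol KE] := FP_superposition mb msigma s0 cM sol mnu cost_fin.
  have if_eval t0 B0 y : nu y t0 B0 =
      if y \in A then S (dirac_prob y) t0 B0 else S q t0 B0.
    by rewrite /nu; case: ifP.
  have KE' t0 B0 : s <= t0 -> measurable (B0 : set (borel Rd)) ->
      K t0 B0 = (\int[theta]_(y in A) S (dirac_prob y) t0 B0 +
       \int[theta]_(y in ~` A) S q t0 B0)%E.
    move=> st0 mB0; rewrite KE//; under eq_integral do rewrite if_eval.
    by rewrite ge0_integral_if//; exact: measurable_S_eval.
  rewrite -(S_unique Ksol _ st mB); first exact: KE'.
  (* The initial value of the superposition is [theta]. *)
  move=> B0 mB0; rewrite KE'//.
  have mAC := measurableC mA.
  rewrite integral_cst// (S_init q mB0) muleC qE//.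
  rewrite (eq_integral (fun y => (\1_B0 y)%:E)); last first.
    by move=> y _; rewrite (S_init (dirac_prob y) mB0) /dirac_prob/= diracE indicE.
  rewrite integral_indic// -measureU//; [|exact: measurableI..|].
    by rewrite -setIUr setUv setIT.
  by rewrite setIACA setICr setI0.
have bound (A : set (borel Rd)) (e : R) (f : borel Rd -> \bar R) : measurable A ->
    (theta A <= e%:E)%E -> measurable_fun [set: borel Rd] f ->
    (forall y, (0 <= f y <= 1)%E) -> (\int[theta]_(y in A) f y <= e%:E)%E.
  move=> mA tA mf f01; apply: le_trans tA.
  rewrite -[leRHS]mul1e -(integral_cst theta mA); apply: ge0_le_integral => //.
  - by move=> y _; case/andP: (f01 y).
  - exact: measurable_funTS.
  - by move=> y _; case/andP: (f01 y).
have p01 (p : P) : (0 <= p B <= 1)%E by rewrite measure_ge0 probability_le1.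
have mSB := measurable_S_eval st mB.
have split_int (A : set (borel Rd)) : measurable A ->
    (\int[theta]_y S (dirac_prob y) t B =
     \int[theta]_(y in A) S (dirac_prob y) t B +
     \int[theta]_(y in ~` A) S (dirac_prob y) t B)%E.
  move=> mA; rewrite -(ge0_integral_if theta mA mSB mSB) //.
  by apply: eq_integral => y _; case: ifP.
apply/eqP; rewrite eq_le; apply/andP; split; apply/lee_addgt0Pr => e e0.
- have [A [q [mA tA ->]]] := approx e e0; rewrite (split_int A mA).
  apply: leeD; first by rewrite leeDl// integral_ge0.
  by apply: bound => //; exact: measurableC.
- have [A [q [mA tA ->]]] := approx e e0; rewrite (split_int A mA).
  apply: leeD; first by rewrite leeDl// integral_ge0.
  by apply: bound => //; exact: measurableC.
Qed.

End Disintegration.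

(** * The Markov kernel *)

Section MarkovKernel.
Context (R : realType) (d m : nat).
Local Notation Rd := 'rV[R]_d.
Local Notation P := (Prob R d).

Lemma cb_int_dirac (f : Cb R d) (x : Rd) : cb_int f (dirac_prob x) = sval f x.
Proof.
rewrite /cb_int /Rintegral integral_dirac//; last first.
  by apply/measurable_EFinP; apply: continuous_measurable_rV; have [] := svalP f.
by rewrite diracT mul1e.
Qed.

Lemma dirac_prob_continuous : continuous (@dirac_prob R d).
Proof.
apply/continuous_ProbP => f; rewrite (_ : cb_int f \o _ = sval f).
  by have [] := svalP f.
by apply/funext => x; exact: cb_int_dirac.
Qed.

Lemma borel_meq (B : set P) (p q : P) : measurable (B : set (borel P)) -> meq p q ->
  B p <-> B q.
Proof.
move=> mB pq; apply: borel_indistinguishable => //; apply: meq_cvg => //.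
exact: meq_sym.
Qed.

Lemma borel_rV_prod (W : set (Rd * P)) :
  measurable (W : set (borel (Rd * P)%type)) <->
  measurable (W : set (borel Rd * borel P)%type).
Proof.
split; last exact: prod_borel_measurable.
by have [U bU] := rV_open_base_seq R d; exact: borel_prod_measurable bU.
Qed.

Lemma borel_ysection (B : set (Rd * P)) (p : P) :
  measurable (B : set (borel (Rd * P)%type)) ->
  measurable ([set y | B (y, p)] : set (borel Rd)).
Proof.
move=> /borel_rV_prod/(measurable_ysection (p : borel P)).
by congr (measurable _); apply/seteqP; split => y; rewrite ysectionE.
Qed.

Lemma borel_xsection (B : set (Rd * P)) (x : Rd) :
  measurable (B : set (borel (Rd * P)%type)) ->
  measurable ([set p | B (x, p)] : set (borel P)).
Proof.
move=> /borel_rV_prod/(measurable_xsection (x : borel Rd)).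
by congr (measurable _); apply/seteqP; split => p; rewrite xsectionE.
Qed.

Lemma joint_kernelE mu nu s t z (B : set (Rd * P)) :
  measurable (B : set (borel (Rd * P)%type)) ->
  joint_kernel mu nu s t z B =
  nu s t z.2 (dirac_prob z.1) [set y | B (y, mu s t z.2)].
Proof.
move=> mB; have mBy : measurable ([set y | B (y, mu s t z.2)] : set (borel Rd)).
  exact: borel_ysection.
rewrite /joint_kernel /= /product_measure1.
have -> : nu s t z.2 (dirac_prob z.1) [set y | B (y, mu s t z.2)] =
    (\int[nu s t z.2 (dirac_prob z.1)]_y (\1_[set y | B (y, mu s t z.2)] y)%:E)%E.
  by rewrite integral_indic// setIT.
apply: eq_integral => y _ /=; rewrite diracE indicE.
by rewrite mem_xsection.
Qed.

Variables (b bb : R -> Rd -> P -> Rd) (sigma bsigma : R -> Rd -> P -> 'M[R]_(d, m)).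
Variables (P0 : set P) (A : set (R -> P)).
Variables (mu : R -> R -> P -> P) (nu : R -> R -> P -> P -> P).
Hypotheses (mb : borel_coef b) (mbb : borel_coef bb).
Hypotheses (msigma : borel_coef sigma) (mbsigma : borel_coef bsigma).
Hypothesis hP : property_P P0 A.
Hypothesis hwp : well_posed b sigma bb bsigma P0 A mu nu.

Lemma mu_solution s zeta : 0 <= s -> P0 zeta ->
  [/\ FP_solution b sigma s (fun t => mu s t zeta) (fun t => mu s t zeta),
      meq (mu s s zeta) zeta & A (fun t => mu s (s + t) zeta)].
Proof. by move=> s0 z0; have [/(_ s zeta s0 z0)[]] := hwp. Qed.

Lemma mu_continuous s zeta : 0 <= s -> P0 zeta ->
  {within `[s, +oo[%classic, continuous (fun t => mu s t zeta)}.
Proof. by move=> s0 z0; have [[]] := mu_solution s0 z0. Qed.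

Lemma mu_P0 s t zeta : 0 <= s -> s <= t -> P0 zeta -> P0 (mu s t zeta).
Proof.
move=> s0 st z0; have [_ _ Amu] := mu_solution s0 z0.
have [_ AP _ _ _] := hP; have [_ /(_ (t - s))] := AP _ Amu.
by rewrite subr_ge0 subrKC; apply.
Qed.

(** The path from time [s], restarted at [r], solves the equation from time [r];
    the shift invariance of [A] makes it a competitor for uniqueness. *)
Lemma mu_flow s r t zeta : 0 <= s -> s <= r -> r <= t -> P0 zeta ->
  meq (mu s t zeta) (mu r t (mu s r zeta)).
Proof.
move=> s0 sr rt z0; have [sol _ Amu] := mu_solution s0 z0.
have r0 := le_trans s0 sr.
have [/(_ r _ r0 (mu_P0 s0 sr z0))[_ uniq] _ _ _] := hwp.
apply: (uniq (fun t => mu s t zeta)) => //; split => //.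
- have cmu := mu_continuous s0 z0.
  exact: (FP_solution_restrict mb msigma s0 cmu sr sol).
- have [_ _ _ shift _] := hP; have := shift _ Amu (r - s).
  rewrite subr_ge0 => /(_ sr); congr (A _); apply/funext => u.
  by rewrite addrA subrKC.
Qed.

Lemma nu_solution s theta zeta : 0 <= s -> P0 zeta ->
  FP_solution bb bsigma s (fun t => mu s t zeta) (fun t => nu s t zeta theta) /\
  meq (nu s s zeta theta) theta.
Proof. by move=> s0 z0; have [_ _ /(_ s theta zeta s0 z0)[]] := hwp. Qed.

Lemma nu_unique s theta zeta nu' : 0 <= s -> P0 zeta ->
  FP_solution bb bsigma s (fun t => mu s t zeta) nu' -> meq (nu' s) theta ->
  forall t, s <= t -> meq (nu' t) (nu s t zeta theta).
Proof.
move=> s0 z0 sol init; have [_ _ /(_ s theta zeta s0 z0)[_ uniq] _] := hwp.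
exact: uniq.
Qed.

(** Likewise, once [mu_flow] has identified the measures that enter the
    coefficients. *)
Lemma nu_flow s r t zeta theta : 0 <= s -> s <= r -> r <= t -> P0 zeta ->
  meq (nu s t zeta theta) (nu r t (mu s r zeta) (nu s r zeta theta)).
Proof.
move=> s0 sr rt z0; have r0 := le_trans s0 sr.
have [sol _] := nu_solution theta s0 z0.
apply: (@nu_unique r _ _ (fun t => nu s t zeta theta)) => //.
  exact: mu_P0.
apply: (@FP_solution_meq _ _ _ _ _ mbb mbsigma r (fun t => mu s t zeta)) => //.
  by move=> u ru; exact: mu_flow.
have cmu := mu_continuous s0 z0.
exact: (FP_solution_restrict mbb mbsigma s0 cmu sr sol).
Qed.

Let E : set (Rd * P) := setT `*` P0.

Lemma measurable_state_space : measurable (E : set (borel (Rd * P)%type)).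
Proof.
apply: prod_borel_measurable; apply: measurableX => //.
by have [] := hP.
Qed.

Lemma measurable_nu_dirac s t : 0 <= s -> s <= t ->
  measurable_fun (E : set (borel (Rd * P)%type))
    (fun z : borel (Rd * P)%type => nu s t z.2 (dirac_prob z.1) : borel P).
Proof.
move=> s0 st; have [_ _ _ /(_ s t s0 st) mnu] := hwp.
have mD : measurable ([set z | P0 z.2] : set (borel (P * P)%type)).
  have [mP0 _ _ _ _] := hP.
  have := continuous_borel (@continuous_snd P P) measurableT mP0.
  by rewrite setTI.
apply: (measurable_comp mD _ mnu (g := fun z : borel (Rd * P)%type =>
    ((dirac_prob z.1, z.2) : borel (P * P)%type))).
  by move=> _ [[x zeta] [_ z0] <-].
apply: measurable_funTS; apply: continuous_borel.
apply: continuous_pair; last exact: continuous_snd.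
exact: continuous_comp2 (@continuous_fst Rd P) dirac_prob_continuous.
Qed.

Lemma nu_disintegration s t zeta theta B : 0 <= s -> s <= t -> P0 zeta ->
  measurable (B : set (borel Rd)) ->
  nu s t zeta theta B = (\int[theta]_y nu s t zeta (dirac_prob y) B)%E.
Proof.
move=> s0 st z0 mB.
apply: (@solution_disintegration R d m bb bsigma mbb mbsigma s
  (fun t => mu s t zeta) s0 (mu_continuous s0 z0)
  (fun theta t => nu s t zeta theta)) => //.
- by move=> th; have [] := nu_solution th s0 z0.
- by move=> th; have [] := nu_solution th s0 z0.
- by move=> th nu' sol init; exact: nu_unique.
- move=> u f su.
  apply: (measurableT_comp (measurable_cb_int f)).
  apply: (measurable_comp measurable_state_space _ (measurable_nu_dirac s0 su)
    (g := fun y : borel Rd => ((y, zeta) : borel (Rd * P)%type))).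
    by move=> _ [y _ <-].
  apply: continuous_borel; apply: continuous_pair; last exact: cst_continuous.
  by move=> x; exact: cvg_id.
Qed.

Local Notation K := (joint_kernel mu nu).

Lemma joint_kernel_mass s t z : 0 <= s -> s <= t -> E z -> K s t z E = 1%E.
Proof.
move=> s0 st [_ z0]; rewrite joint_kernelE; last exact: measurable_state_space.
rewrite (_ : [set y | _] = setT); first exact: probability_setT.
by apply/seteqP; split => // y _; split => //=; exact: mu_P0.
Qed.

Lemma measurable_mu_snd s t : 0 <= s -> s <= t ->
  measurable_fun (E : set (borel (Rd * P)%type))
    (fun z : borel (Rd * P)%type => mu s t z.2 : borel P).
Proof.
move=> s0 st; have [_ /(_ s t s0 st) mmu _ _] := hwp; have [mP0 _ _ _ _] := hP.
apply: (measurable_comp mP0 _ mmu (g := fun z : borel (Rd * P)%type => z.2 : borel P)).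
  by move=> _ [[x zeta] [_ z0] <-].
by apply: measurable_funTS; apply: continuous_borel; exact: continuous_snd.
Qed.

(** [K s t z B] is the integral against [nu s t] of the section of [B] at [mu s t].
    Outside of the state space both are replaced by a default value, so that the
    measurability of parametrized integrals applies on the whole product. *)
Lemma measurable_joint_kernel s t B : 0 <= s -> s <= t ->
  measurable (B : set (borel (Rd * P)%type)) ->
  measurable_fun (E : set (borel (Rd * P)%type)) (fun z => K s t z B).
Proof.
move=> s0 st mB; have mE := measurable_state_space.
have mbE : measurable_fun [set: borel (Rd * P)%type] (fun z => z \in E).
  by apply: (measurable_fun_bool true); rewrite setTI /preimage/= set_mem_set.
have EE : [set: borel (Rd * P)%type] `&` (fun z => z \in E) @^-1` [set true] = E.
  by rewrite setTI /preimage/= set_mem_set.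
pose p (z : borel (Rd * P)%type) : borel P := if z \in E then mu s t z.2 else point.
pose k (z : borel (Rd * P)%type) : P :=
  if z \in E then nu s t z.2 (dirac_prob z.1) else point.
have mp : measurable_fun [set: borel (Rd * P)%type] p.
  apply: measurable_fun_if => //.
  by rewrite EE; exact: measurable_mu_snd.
have mk C : measurable (C : set (borel Rd)) ->
    measurable_fun [set: borel (Rd * P)%type] (fun z => k z C).
  move=> mC; have -> : (fun z => k z C) = (fun z : borel (Rd * P)%type =>
      if z \in E then nu s t z.2 (dirac_prob z.1) C else (point : P) C).
    by apply/funext => z; rewrite /k; case: ifP.
  apply: measurable_fun_if => //.
  rewrite EE; apply: (measurableT_comp (measurable_Prob_eval mC)).
  exact: measurable_nu_dirac.
pose g (w : borel (Rd * P)%type * borel Rd) : \bar R := (\1_B (w.2, p w.1))%:E.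
have mg : measurable_fun [set: borel (Rd * P)%type * borel Rd] g.
  apply/measurable_EFinP.
  have mB' : measurable (B : set (borel Rd * borel P)%type) by exact/borel_rV_prod.
  apply: (measurableT_comp (measurable_indic mB')
    (g := fun w : borel (Rd * P)%type * borel Rd => (w.2, p w.1) : borel Rd * borel P)).
  apply: measurable_fun_pair; first exact: measurable_snd.
  by apply: (measurableT_comp mp); exact: measurable_fst.
have g0 w : (0 <= g w)%E by rewrite lee_fin.
have mint := measurable_kernel_integral mk g0 mg.
apply: (eq_measurable_fun (fun z => \int[k z]_y g (z, y))%E); last first.
  exact: measurable_funTS mint.
move=> z zE; rewrite joint_kernelE// /g /k /p zE /=.
have mBy : measurable ([set y | B (y, mu s t z.2)] : set (borel Rd)).
  exact: borel_ysection.
rewrite (eq_integral (fun y : borel Rd =>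
    (\1_([set y | B (y, mu s t z.2)] : set (borel Rd)) y)%:E)); last first.
  by move=> y _.
by rewrite integral_indic// setIT.
Qed.

Lemma joint_kernel_init s z B : 0 <= s -> E z ->
  measurable (B : set (borel (Rd * P)%type)) ->
  K s s z B = \d_(z : borel (Rd * P)%type) B.
Proof.
move=> s0 [_ z0] mB; rewrite joint_kernelE//.
have [_ mus _] := mu_solution s0 z0.
have [_ nus] := nu_solution (dirac_prob z.1) s0 z0.
have mBy : measurable ([set y | B (y, mu s s z.2)] : set (borel Rd)).
  exact: borel_ysection.
have mBx : measurable ([set p | B (z.1, p)] : set (borel P)).
  exact: borel_xsection.
rewrite nus// /dirac_prob/= !diracE.
have h := borel_meq mBx mus.
suff -> : (z.1 \in [set y | B (y, mu s s z.2)]) = (z \in B) by [].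
case: z z0 h {mus nus mBy mBx} => x zeta /= _ h.
by apply/idP/idP; rewrite !inE; apply h.
Qed.

(** The first kernel is carried by [borel Rd] times the point [eta := mu s r z.2],
    so that the right-hand side is the integral of [nu r t eta (dirac_prob y)]
    against [nu s r z.2 (dirac_prob z.1)], taken on the section of [B] at
    [mu r t eta]. Disintegration and the two flow properties conclude. *)
Lemma joint_kernel_chapman_kolmogorov s r t z B :
  0 <= s -> s < r -> r < t -> E z ->
  measurable (B : set (borel (Rd * P)%type)) ->
  K s t z B = (\int[K s r z]_(w in E) K r t w B)%E.
Proof.
move=> s0 /ltW sr /ltW rt Ez mB; have [_ z0] := Ez.
have r0 := le_trans s0 sr; have mK := measurable_joint_kernel r0 rt mB.
have mE : measurable (E : set (borel Rd * borel P)%type).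
  by apply/borel_rV_prod; exact: measurable_state_space.
have mKp : measurable_fun (E : set (borel Rd * borel P)%type)
    (fun z => K r t z B).
  by move=> _ C mC; apply/borel_rV_prod; exact: mK measurable_state_space _ mC.
set eta := mu s r z.2; have eta0 : P0 eta by exact: mu_P0.
pose F : borel Rd * borel P -> \bar R := (fun w => K r t w B) \_ E.
have mF : measurable_fun [set: borel Rd * borel P] F.
  exact: (measurable_restrictT _ mE).1 mKp.
have F0 w : (0 <= F w)%E by rewrite /F /patch; case: ifP.
have mF2 y : measurable_fun [set: borel P] (fun p : borel P => F (y, p)).
  by apply: (measurableT_comp mF); exact: pair1_measurable.
rewrite integral_mkcond -/F.
rewrite (@fubini_tonelli1 _ _ (borel Rd) (borel P) R (nu s r z.2 (dirac_prob z.1))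
  (\d_(eta : borel P)) F mF F0).
have FE (y : borel Rd) : fubini_F \d_(eta : borel P) F y =
    nu r t eta (dirac_prob y) [set y' | B (y', mu r t eta)].
  rewrite /fubini_F integral_dirac// diracT mul1e /F patchE mem_set//.
  by rewrite joint_kernelE.
under eq_integral do rewrite FE.
have mBe (p : P) : measurable ([set y | B (y, p)] : set (borel Rd)).
  exact: borel_ysection.
rewrite -nu_disintegration// joint_kernelE//.
rewrite -(@nu_flow s r t z.2 (dirac_prob z.1) s0 sr rt z0 _ (mBe _)).
congr (nu _ _ _ _ _); apply/funext => y; apply/propext.
have mBy : measurable ([set p | B (y, p)] : set (borel P)).
  exact: borel_xsection.
exact: (borel_meq mBy (mu_flow s0 sr rt z0)).
Qed.

End MarkovKernel.

Theorem proposition4p8 (R : realType) (d m : nat)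
    (b bb : R -> 'rV[R]_d -> Prob R d -> 'rV[R]_d)
    (sigma bsigma : R -> 'rV[R]_d -> Prob R d -> 'M[R]_(d, m))
    (P0 : set (Prob R d)) (A : set (R -> Prob R d))
    (mu : R -> R -> Prob R d -> Prob R d)
    (nu : R -> R -> Prob R d -> Prob R d -> Prob R d)
    (mb : borel_coef b) (mbb : borel_coef bb)
    (msigma : borel_coef sigma) (mbsigma : borel_coef bsigma)
    (hP : property_P P0 A)
    (hwp : well_posed b sigma bb bsigma P0 A mu nu) :
  markov_kernel P0 (joint_kernel mu nu).
Proof.
split.
- move=> s t z s0 st Ez; exact: (joint_kernel_mass hP hwp s0 st Ez).
- move=> s t B s0 st [mB _]; exact: (measurable_joint_kernel hP hwp s0 st mB).
- move=> s z B s0 Ez [mB _]; exact: (joint_kernel_init hwp s0 Ez mB).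
- move=> s r t z B s0 sr rt Ez [mB _].
  exact: (joint_kernel_chapman_kolmogorov mb mbb msigma mbsigma hP hwp
    s0 sr rt Ez mB).
Qed.
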